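(* Let $\lambda>0$ and $\nu\in(0,1]$. The solution $\widehat{p}_k^{\nu}(t)$, for $k=0,1,\dots$ and $t\ge 0$, of the Cauchy problem $$\frac{d^{2\nu}p_k}{dt^{2\nu}}+2\lambda\frac{d^{\nu}p_k}{dt^{\nu}}=-\lambda^{2}(p_k-p_{k-1}),\qquad k\ge 0,$$ with $p_{-1}(t)=0$ and initial conditions $$p_k(0)=\begin{cases}1,& k=0\\ 0,& k\ge 1\end{cases}\quad\text{for } 0<\nu\le 1,\qquad p_k'(0)=0,\ k\ge 0,\quad\text{for }\tfrac12<\nu\le 1,$$ is given by $$\widehat{p}_k^{\nu}(t)=\lambda^{2k}t^{2k\nu}E_{\nu,2k\nu+1}^{2k+1}(-\lambda t^{\nu})+\lambda^{2k+1}t^{(2k+1)\nu}E_{\nu,(2k+1)\nu+1}^{2k+2}(-\lambda t^{\nu}),\qquad k\ge 0,\ t>0.$$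
   Context: Fractional derivatives of order $\mu>0$ (here $\mu=\nu$ and $\mu=2\nu$) are in the sense of Caputo: for $m\in\mathbb{N}$, $$\frac{d^{\mu}}{dt^{\mu}}u(t)=\begin{cases}\dfrac{1}{\Gamma(m-\mu)}\displaystyle\int_0^t\frac{1}{(t-s)^{1+\mu-m}}\frac{d^m}{ds^m}u(s)\,ds, & m-1<\mu<m,\\[2mm] \dfrac{d^m}{dt^m}u(t), & \mu=m.\end{cases}$$ The generalized Mittag-Leffler function is $$E_{\alpha,\beta}^{\gamma}(z)=\sum_{r=0}^{\infty}\frac{(\gamma)_r\,z^r}{r!\,\Gamma(\alpha r+\beta)},\qquad \alpha,\beta,\gamma\in\mathbb{C},\ \mathrm{Re}(\alpha),\mathrm{Re}(\beta),\mathrm{Re}(\gamma)>0,$$ where $(\gamma)_r=\gamma(\gamma+1)\cdots(\gamma+r-1)$ for $r\ge 1$ and $(\gamma)_0=1$. *)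

(* Defs.v *)
From HB Require Import structures.
From mathcomp Require Import all_boot all_order all_algebra.
From mathcomp Require Import all_classical all_reals all_analysis.
Set Implicit Arguments.
Unset Strict Implicit.
Unset Printing Implicit Defensive.
Import Order.TTheory GRing.Theory Num.Theory.
Import numFieldNormedType.Exports.
Local Open Scope classical_set_scope.
Local Open Scope ring_scope.

(* Euler's Gamma function; the integral converges for 0 < x, which is the only
   range in which it is used. *)
Definition Gamma (R : realType) (x : R) : R :=
  \int[lebesgue_measure]_(t in `]0, +oo[) (t `^ (x - 1) * expR (- t)).

Definition pochhammer (R : realType) (c : R) (r : nat) : R :=
  \prod_(i < r) (c + i%:R).

(* Generalized (three-parameter) Mittag-Leffler function E_{a,b}^c(z), for real
   arguments and positive real parameters, where the series converges. *)
Definition mittag_leffler (R : realType) (a b c z : R) : R :=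
  limn (series (fun r : nat =>
    pochhammer c r * z ^+ r / (r`!%:R * Gamma (a * r%:R + b)))).

(* For 0 < mu, the unique m : nat with m - 1 < mu <= m. *)
Definition caputo_order (R : realType) (mu : R) : nat := `|Num.ceil mu|%N.

Definition caputo_integrand (R : realType) (mu : R) (u : R -> R) (t s : R) : R :=
  let m := caputo_order mu in
  ((t - s) `^ (1 + mu - m%:R))^-1 * derive1n m u s.

Definition caputo (R : realType) (mu : R) (u : R -> R) (t : R) : R :=
  let m := caputo_order mu in
  if mu == m%:R then derive1n m u t
  else (Gamma (m%:R - mu))^-1 *
       \int[lebesgue_measure]_(s in `]0, t[) caputo_integrand mu u t s.

(* The derivatives and the integral in [caputo mu u t] exist for all t > 0.
   ([derive1n] and the integral are total functions, so that this has to be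
   required separately.)  Only the values of u on ]0, +oo[ matter. *)
Definition caputo_derivable (R : realType) (mu : R) (u : R -> R) : Prop :=
  let m := caputo_order mu in
  (forall (j : nat) (s : R), (j < m)%N -> 0 < s -> derivable (derive1n j u) s 1) /\
  (mu != m%:R -> forall t : R, 0 < t ->
     lebesgue_measure.-integrable `]0, t[ (EFin \o caputo_integrand mu u t)).

(* p_{k-1}, with p_{-1} = 0. *)
Definition prev (R : realType) (p : nat -> R -> R) (k : nat) (t : R) : R :=
  if k is j.+1 then p j t else 0.

(* The functions p k are considered on [0, +oo[ only: the equation is required
   for t > 0, the initial values are attained continuously, and p_k'(0) is the
   one-sided derivative. *)
Record cauchy_solution (R : realType) (lam nu : R) (p : nat -> R -> R) : Prop :=
  CauchySolution {
    sol_continuous : forall k, {within `[0, +oo[, continuous (p k)};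
    sol_derivable : forall k, caputo_derivable nu (p k);
    sol_derivable2 : forall k, caputo_derivable (2 * nu) (p k);
    sol_equation : forall k t, 0 < t ->
      caputo (2 * nu) (p k) t + 2 * lam * caputo nu (p k) t =
      - lam ^+ 2 * (p k t - prev p k t);
    sol_init : forall k, p k 0 = if k == 0%N then 1 else 0;
    sol_init' : 1 / 2 < nu -> forall k,
      (p k h - p k 0) / h @[h --> 0^'+] --> (0 : R)
  }.

(* Main.v *)
(** Put [k_a s = s ^ (a - 1) / Gamma a] for [s > 0], so that [k_a * k_b = k_(a + b)] and the
    fractional integral of order [a] is [I^a u = k_a * u].  Applying [I^(2 nu)] to the equation
    turns the Cauchy problem into the Volterra equation
    [u - u(0) + 2 lam I^nu (u - u(0)) = - lam^2 I^(2 nu) (u - u_prev)], where [u_prev] is the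
    previous component; the norm [sup_s |u s| exp (- c s)] with [c] large shows that its
    continuous solution is unique.  As the derivatives of a solution are only known to exist
    pointwise and to be integrable, the fundamental theorem of calculus is needed for everywhere
    differentiable functions; it follows from a lower semicontinuous majorant of the derivative
    (Vitali-Caratheodory).

    With [X^n] for [k_(nu n + 1)], the operator [I^nu] is multiplication by [X], the Volterra
    equations become [(1 + lam X)^2 u_0 = 1 + 2 lam X] and [(1 + lam X)^2 u_k = lam^2 X^2 u_(k-1)],
    and [u_k = (lam X)^(2 k) (1 + 2 lam X) / (1 + lam X)^(2 k + 2)] expands into the claimed
    Mittag-Leffler series.  Its coefficient of [X] vanishes, so that for [nu > 1/2] the
    derivative at 0 is 0. *)

Require Import Defs.
From HB Require Import structures.
From mathcomp Require Import all_boot all_order all_algebra.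
From mathcomp Require Import all_classical all_reals all_analysis.
From mathcomp Require Import measurable_realfun ring lra.
Set Implicit Arguments.
Unset Strict Implicit.
Unset Printing Implicit Defensive.
Import Order.TTheory GRing.Theory Num.Theory.
Import numFieldNormedType.Exports.
Local Open Scope classical_set_scope.
Local Open Scope ring_scope.

Local Notation leb := lebesgue_measure.

(** * The fundamental theorem of calculus for everywhere differentiable functions *)

(** At non-integer order, [caputo_derivable] makes a derivative integrable against a kernel of order
    below 1; such a kernel is bounded below on []0, t[], so the derivative itself is integrable. At
    integer order nothing is required, and for [nu = 1] the integrability has to be recovered from
    the equation [u'' + 2 lam u' = q] with [q] continuous.

    For a function that is merely integrable, [I^a I^b f = I^(a + b) f] holds in general only almost
    everywhere, whereas the Volterra equation is wanted at every [t]. If [a + b >= 1] the kernel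
    [k_(a + b)] is locally bounded and the law holds everywhere; all compositions applied to
    derivatives of a solution are arranged to have total order at least 1.

    The two summands of the formula come from [1 + 2 lam X = (1 + lam X) + lam X], which makes [u_k]
    the sum of [(lam X)^m / (1 + lam X)^(m + 1)] for [m = 2 k] and [m = 2 k + 1]. *)

Lemma increment_le (R : realType) (F G : R -> R) (a b : R) : a <= b ->
  {within `[a, b], continuous F} ->
  {in `[a, b] &, {homo G : x y / x <= y}} ->
  (forall x e, x \in `]a, b[ -> 0 < e ->
    \forall y \near x^'+, F y - F x <= G y - G x + e * (y - x)) ->
  F b - F a <= G b - G a.
Proof.
move=> ab cF ndG loc.
suff H e : 0 < e -> F b - F a <= G b - G a + e * (b - a + 1).
  apply/ler_addgt0Pr => e e0.
  have ba1 : 0 < b - a + 1 by rewrite ltr_wpDl// subr_ge0.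
  by have := H (e / (b - a + 1)) (divr_gt0 e0 ba1); rewrite divfK// gt_eqF.
move=> e0.
(* Supremum argument: the bound with slack [e] passes to the supremum and extends beyond it. The
   summand 1 gives a head start at [a], where no local bound is assumed. [G] is only monotone, which
   suffices because [G y <= G c] for [y <= c]. *)
pose S := [set y | [/\ a <= y, y <= b & F y - F a <= G y - G a + e * (y - a + 1)]].
have Sa : S a by split => //; rewrite !subrr !add0r mulr1 ltW.
have hS : has_sup S by split; [exists a | exists b => y []].
pose c := sup S.
have ac : a <= c by exact: ub_le_sup hS.2 _ Sa.
have cb : c <= b by apply: ge_sup; [exists a|move=> y []].
have cabP : c \in `[a, b] by rewrite in_itv/= ac.
have near_c (r : R) : 0 < r -> exists2 d, 0 < d &
    forall y, `|c - y| < d -> a <= y -> y <= b -> `|F c - F y| < r.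
  move=> r0; have /subspace_continuousP /(_ c) := cF.
  move=> /(_ cabP) /cvgrPdist_lt/(_ r r0).
  rewrite near_withinE => -[d /= d0 hd]; exists d => // y yd ay yb.
  by apply: hd => //=; rewrite in_itv/= ay.
have Sc : S c.
  split => //; rewrite leNgt; apply/negP => Hlt.
  pose r := F c - F a - (G c - G a + e * (c - a + 1)).
  have r0 : 0 < r by rewrite subr_gt0.
  have [d d0 hd] := near_c r r0.
  have [y Sy cy] := sup_adherent d0 hS.
  have yc : y <= c by exact: ub_le_sup hS.2 _ Sy.
  case: Sy => ay yb hy.
  have := hd y; rewrite ger0_norm ?subr_ge0// => /(_ _ ay yb).
  have -> : c - y < d by rewrite /c; lra.
  move=> /(_ isT) /ltr_normlW Fcy.
  have Gyc : G y <= G c by apply: ndG => //; rewrite in_itv/= ay.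
  have : e * (y - a + 1) <= e * (c - a + 1) by rewrite ler_pM2l// lerD2r lerB.
  rewrite /r in Fcy; lra.
have [->|cb'] := eqVneq b c; first by case: Sc.
have {cb'} ltcb : c < b by rewrite lt_neqAle eq_sym cb' cb.
suff [y cy Sy] : exists2 y, c < y & S y.
  by have := ub_le_sup hS.2 Sy; rewrite leNgt cy.
(* At [a] only the continuity of [F] is available: its variation stays below the head start [e]. *)
have [ca|ac'] := eqVneq c a.
  have [d d0 hd] := near_c e e0.
  pose y := Num.min b (c + d / 2).
  have cy : c < y by rewrite lt_min ltcb ltrDl divr_gt0.
  have yb : y <= b by rewrite ge_min lexx.
  have ycd : y <= c + d / 2 by rewrite ge_min lexx orbT.
  exists y => //; split => //; first by rewrite -ca ltW.
  have := hd y; rewrite distrC gtr0_norm ?subr_gt0//.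
  rewrite -ca (ltW cy) yb => /(_ _ isT isT).
  have -> : y - c < d by lra.
  move=> /(_ isT); rewrite distrC => /ltr_normlW Fy.
  have Gy : G c <= G y.
    by apply: ndG; rewrite ?in_itv/= ?yb ?(ltW cy)  ?(le_trans ac (ltW cy)) ?ca ?lexx ?ab // -ca ltW.
  have : e * 1 <= e * (y - c + 1) by rewrite ler_pM2l// lerDr subr_ge0 ltW.
  lra.
have {ac'} ltac : a < c by rewrite lt_neqAle eq_sym ac' ac.
have /loc /(_ e0) near_y : c \in `]a, b[ by rewrite in_itv/= ltac.
have : \forall y \near c^'+, F y - F c <= G y - G c + e * (y - c) /\ (c < y /\ y < b).
  near=> y; split; first by near: y.
  split; first by near: y; exact: nbhs_right_gt.
  by near: y; exact: nbhs_right_lt.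
move=> /(@filter_ex _ _ (at_right_proper_filter c)) [y [hy [cy yb]]]; exists y => //; split; [|exact: ltW|].
  by rewrite (le_trans ac) ?ltW.
case: Sc => _ _ hc.
rewrite [e * _](_ : _ = e * (y - c) + e * (c - a + 1)); last by ring.
lra.
Unshelve. all: by end_near. Qed.

Lemma leb_setU_le (R : realType) (A B : set R) : measurable A -> measurable B ->
  (leb (A `|` B) <= leb A + leb B)%E.
Proof. by move=> mA mB; apply: measureU2. Qed.

Lemma leb_le (R : realType) (A B : set R) :
  measurable A -> measurable B -> A `<=` B -> (leb A <= leb B)%E.
Proof. by move=> mA mB AB; apply: le_measure => //; rewrite inE. Qed.

Lemma layer_sum_le (R : realType) (e v : R) : 0 < e -> 0 <= v ->
  (\sum_(0 <= j <oo) (e * ((j.+1)%:R * e <= v)%R%:R)%:E <= v%:E)%E.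
Proof.
move=> e0 v0.
apply: lime_le => [|]; first by apply: is_cvg_nneseries => n _ _; rewrite lee_fin mulr_ge0// ltW.
apply: nearW => n; rewrite sumEFin lee_fin.
(* The bound [n%:R * e] carries the induction: if the next layer counts, the new sum is at most
   [n.+1%:R * e <= v]. *)
suff /andP[] : (\sum_(0 <= j < n) e * ((j.+1)%:R * e <= v)%R%:R <= v) &&
  (\sum_(0 <= j < n) e * ((j.+1)%:R * e <= v)%R%:R <= n%:R * e) by [].
elim: n => [|n /andP[IH1 IH2]]; first by rewrite big_geq// v0 mul0r lexx.
rewrite big_nat_recr//=.
have : n.+1%:R * e = n%:R * e + e by rewrite -addn1 natrD mulrDl mul1r.
case: (leP (n.+1%:R * e) v) => /= h h1; rewrite ?mulr1 ?mulr0; apply/andP; split; lra.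
Qed.

(* [f] is up to [e] the sum of [e] times the indicators of its superlevel sets [A j]; [g] is
   obtained by enlarging these to open sets of almost the same measure. *)
Lemma lsc_majorant (R : realType) (a b : R) (f : R -> R) (eps : R) : a < b -> 0 < eps ->
  measurable_fun `]a, b[ f -> (forall x, x \in `]a, b[ -> 0 <= f x) ->
  exists g : R -> \bar R, [/\ measurable_fun setT g, forall y, (0 <= g y)%E,
    (\int[leb]_(x in `]a, b[) g x <=
     \int[leb]_(x in `]a, b[) (f x)%:E + eps%:E)%E &
    forall x, x \in `]a, b[ -> \forall y \near x, ((f x)%:E <= g y)%E].
Proof.
move=> ab eps0 mf f0.
(* The constant [e] added to the layers costs [e * (b - a)]. The open sets exceed the level sets by
   at most [1 / 2 ^ (j + 1)] each, which costs [e] in total. *)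
pose e := eps / (b - a + 1).
have ba1 : 0 < b - a + 1 by rewrite ltr_wpDl// subr_ge0 ltW.
have e0 : 0 < e by rewrite divr_gt0.
pose A j := `]a, b[ `&` [set x | j.+1%:R * e <= f x].
have mA j : measurable (A j).
  have -> : A j = `]a, b[ `&` f @^-1` `[j.+1%:R * e, +oo[.
    by apply/seteqP; split => x [/= xD hx]; split => //=; move: hx; rewrite in_itv/= andbT.
  exact: mf.
have muD : (leb `]a, b[%classic = (b - a)%:E)%E by rewrite lebesgue_measure_itv/= lte_fin ab.
have muA j : (leb (A j) < +oo)%E.
  apply: (@le_lt_trans _ _ (leb `]a, b[%classic)); last by rewrite muD ltry.
  by apply: leb_le => // x [].
have /choice[V hV] : forall j, exists U : set R, [/\ open U, A j `<=` U &
    (leb (U `\` A j) < (1 / (2 ^ j.+1)%:R)%:E)%E].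
  by move=> j; apply: lebesgue_regularity_outer => //; exact: muA.
have mV j : measurable (V j) by apply: open_measurable; case: (hV j).
have mterm (B : set R) : measurable B -> measurable_fun setT (fun x => (e * \1_B x)%:E).
  by move=> mB; apply/measurable_EFinP; apply: measurable_funM => //; exact: measurable_indic.
have term0 (B : set R) x : (0 <= (e * \1_B x)%:E)%E by rewrite lee_fin mulr_ge0// ltW.
have S0 y : (0 <= \sum_(0 <= j <oo) (e * \1_(V j) y)%:E)%E by apply: nneseries_ge0.
have mS : measurable_fun setT (fun y => \sum_(0 <= j <oo) (e * \1_(V j) y)%:E)%E.
  by apply: ge0_emeasurable_sum => // j _; exact: mterm.
exists (fun y => e%:E + \sum_(0 <= j <oo) (e * \1_(V j) y)%:E)%E; split.
- exact: emeasurable_funD.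
- by move=> y; rewrite adde_ge0// lee_fin ltW.
- rewrite ge0_integralD//; last 2 first.
    by move=> x _; rewrite lee_fin ltW.
    exact: measurable_funTS.
  rewrite integral_cst// [X in (e%:E * X + _)%E](_ : _ = (b - a)%:E); last exact: muD.
  rewrite integral_nneseries//; last by move=> n; apply: measurable_funTS; exact: mterm.
  have intV (B : set R) : measurable B ->
      (\int[leb]_(x in `]a, b[) (e * \1_B x)%:E = e%:E * leb (B `&` `]a, b[))%E.
    move=> mB; under eq_integral do rewrite EFinM.
    rewrite ge0_integralZl_EFin//; last exact: ltW.
      by rewrite integral_indic.
    by apply/measurable_EFinP; exact: measurable_indic.
  have intV0 (B : set R) : (0 <= \int[leb]_(x in `]a, b[) (e * \1_B x)%:E)%E.
    by apply: integral_ge0 => x _; exact: term0.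
  have step j : (\int[leb]_(x in `]a, b[) (e * \1_(V j) x)%:E <=
      \int[leb]_(x in `]a, b[) (e * \1_(A j) x)%:E + e%:E * (1 / (2 ^ j.+1)%:R)%:E)%E.
    rewrite !intV// -muleDr// ?fin_num_adde_defl//.
    rewrite lee_pmul2l// ?lte_fin//.
    have -> : V j `&` `]a, b[ = (A j) `|` ((V j `\` A j) `&` `]a, b[).
      have [_ AV _] := hV j.
      apply/seteqP; split => x /=.
        by move=> [Vx Dx]; have [Ax|nAx] := pselect (A j x); [left|right].
      by move=> [Ax|[[]]//]; split; [exact: AV|case: Ax].
    have -> : (A j `&` `]a, b[) = A j by rewrite setIidl// => x [].
    apply: (le_trans (leb_setU_le (mA j) _)).
      by apply: measurableI => //; by apply: measurableD; [exact: mV|exact: mA].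
    apply: leeD2l; have [_ _ /ltW] := hV j; apply: le_trans.
    apply: leb_le; [| |by move=> x []]; last by apply: measurableD; [exact: mV|exact: mA].
    by apply: measurableI => //; by apply: measurableD; [exact: mV|exact: mA].
  have := @lee_nneseries R _ _ xpredT 0 _ (fun j _ => step j).
  move=> /(_ (fun i _ _ => intV0 (V i))) hle.
  apply: (le_trans (leeD2l _ hle)).
  rewrite nneseriesD; last 2 first.
    by move=> *; exact: intV0.
    by move=> j _ _; rewrite -EFinM lee_fin mulr_ge0// ltW.
  rewrite nneseriesZl; last by move=> j _; rewrite lee_fin.
  have h1 : (\sum_(0 <= j <oo) \int[leb]_(x in `]a, b[) (e * \1_(A j) x)%:E <=
      \int[leb]_(x in `]a, b[) (f x)%:E)%E.
    rewrite -integral_nneseries//; last by move=> n; apply: measurable_funTS; exact: mterm.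
    apply: ge0_le_integral => //.
    - by move=> x _; apply: nneseries_ge0 => *; exact: term0.
    - by apply: measurable_funTS; apply: ge0_emeasurable_sum => // *; exact: mterm.
    - exact/measurable_EFinP.
    - move=> x xD; rewrite (le_trans _ (layer_sum_le e0 (f0 x xD)))//.
      apply: lee_nneseries => // j _; rewrite lee_fin ler_pM2l// indicE.
      have [|] := boolP (x \in A j) => // /set_mem[_ /= ->]//.
  have h2 : (e%:E * \sum_(0 <= j <oo) (1 / (2 ^ j.+1)%:R)%:E <= e%:E)%E.
    rewrite -[leRHS]mule1; apply: lee_wpmul2l; first by rewrite lee_fin ltW.
    exact: epsilon_trick0.
  apply: (le_trans (leeD2l _ (leeD h1 h2))).
  rewrite addeCA -EFinM -EFinD -{2}(mulr1 e) -mulrDr (_ : e * (b - a + 1) = eps)//.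
  by rewrite divfK// gt_eqF.
- move=> x xD.
  have /truncn_itv : 0 <= f x / e by rewrite divr_ge0 ?f0// ltW.
  (* [x] lies in the first [N] level sets, so a whole neighbourhood lies in their open enlargements;
     there the majorant is at least [e + N * e], which exceeds [f x]. *)
  set N := Num.trunc _ => /andP[Nle Nlt].
  rewrite ler_pdivlMr// in Nle; rewrite ltr_pdivrMr// in Nlt.
  have : \forall y \near x, forall i : 'I_N, V i y.
    apply: (@filter_forall R 'I_N (fun i => V i) (nbhs x) (nbhs_filter x)) => i.
    apply: open_nbhs_nbhs; have [oV AV _] := hV i.
    split=> //; apply: AV; split => //=; rewrite (le_trans _ Nle)// ler_pM2r// ler_nat.
    exact: ltn_ord.
  apply: filterS => y Vy.
  apply: (@le_trans _ _ (e%:E + \sum_(0 <= j < N) (e * \1_(V j) y)%:E)%E); last first.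
    by apply: leeD2l; apply: nneseries_lim_ge.
  rewrite sumEFin -EFinD lee_fin (@eq_big_nat _ _ _ _ _ _ (fun=> e)) => [|j /andP[_ jN]].
    by rewrite sumr_const_nat subn0 -mulrS -mulr_natl ltW.
  by rewrite indicE mem_set ?mulr1//; exact: (Vy (Ordinal jN)).
Qed.

Lemma integrable_cst_itvoo (R : realType) (a b k : R) :
  leb.-integrable `]a, b[ (fun=> k%:E).
Proof.
apply: (@measurable_bounded_integrable _ _ R leb (cst k)) => //.
  have [ab|ab] := ltP a b.
    by have := @lebesgue_measure_itv R `]a, b[; rewrite /= lte_fin ab => ->; rewrite ltry.
  by rewrite set_itv_ge ?measure0// bnd_simp -leNgt.
exact: bounded_cst.
Qed.

Lemma derive_increment (R : realType) (F : R -> R) (x l e : R) : 0 < e ->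
  is_derive x (1 : R) F l ->
  \forall y \near x^'+, F y - F x <= (l + e) * (y - x).
Proof.
move=> e0 [dF Fl].
have : h^-1 *: ((F \o shift x) (h *: (1 : R)) - F x) @[h --> 0^'] --> l.
  by rewrite -Fl; exact: dF.
move=> /cvgrPdist_le/(_ e e0).
rewrite near_withinE => -[d /= d0 hd].
exists d => //= y; rewrite /ball_/= => yd xy.
have := hd (y - x); rewrite /ball_/= sub0r normrN distrC => /(_ yd).
rewrite gt_eqF ?subr_gt0// => /(_ isT).
rewrite /GRing.scale/= mulr1 subrK ler_distlC => /andP[_].
by rewrite mulrC ler_pdivrMr ?subr_gt0.
Qed.

(** A majorant that stays above [f x] on a neighbourhood of each [x] has a primitive that grows to
    the right of [x] at least as fast as [F], up to [e]; then increments are compared. *)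
Lemma ftc_derive_le (R : realType) (F f : R -> R) (a b : R) : a < b ->
  {within `[a, b], continuous F} ->
  (forall x, x \in `]a, b[ -> is_derive x (1 : R) F (f x)) ->
  leb.-integrable `]a, b[ (EFin \o f) ->
  ((F b - F a)%:E <= \int[leb]_(x in `]a, b[) (f x)%:E)%E.
Proof.
move=> ab cF dF intf.
have mf : measurable_fun `]a, b[ f by apply/measurable_EFinP; exact: measurable_int intf.
(* Majorants are built for nonnegative functions: [f] is cut off at [- n] and shifted by [n], and
   the shift is matched by adding [n * y] to [F]. Dominated convergence with [|f|] removes the
   cut-off. *)
pose fn n x := Num.max (f x) (- n%:R).
have mfn n : measurable_fun `]a, b[ (fn n) by exact: measurable_maxr.
suff main n : ((F b - F a)%:E <= \int[leb]_(x in `]a, b[) (fn n x)%:E)%E.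
  have [||||||_ _ hcvg] := @dominated_convergence _ _ R leb `]a, b[ _ (fun n => EFin \o fn n)
    (EFin \o f) (abse \o (EFin \o f)) => //.
  - by move=> n; apply/measurable_EFinP; exact: mfn.
  - by apply/measurable_EFinP; exact: mf.
  - apply: aeW => x _; apply: cvg_near_cst; near=> n.
    rewrite /= /fn max_l//.
    have : - f x <= n%:R by near: n; exact: nbhs_infty_ger.
    lra.
  - exact: integrable_abse.
  - apply: aeW => x n _ /=; rewrite lee_fin /fn.
    have n0 : (0 <= n%:R :> R) by [].
    by case: (leP (f x)) => h //; rewrite normrN ger0_norm//; case: (ger0P (f x)) => ?; lra.
  apply: cvge_to_ge hcvg _.
  by apply: nearW => n; exact: main.
have ifn : leb.-integrable `]a, b[ (EFin \o fn n).
  apply: le_integrable (integrable_abse intf) => //; first by apply/measurable_EFinP; exact: mfn.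
  move=> x _ /=; rewrite lee_fin /fn normr_id.
  have n0 : (0 <= n%:R :> R) by [].
  by case: (leP (f x)) => h //; rewrite normrN ger0_norm//; case: (ger0P (f x)) => ?; lra.
apply/lee_addgt0Pr => eps eps0.
have h0 x : x \in `]a, b[ -> 0 <= fn n x + n%:R.
  by move=> _; rewrite -lerBlDr sub0r /fn le_max lexx orbT.
have mh : measurable_fun `]a, b[ (fun x => fn n x + n%:R) by exact: measurable_funD.
have [g [mg g0 gint glsc]] := lsc_majorant ab eps0 mh h0.
have inth : (\int[leb]_(x in `]a, b[) (fn n x + n%:R)%:E =
    \int[leb]_(x in `]a, b[) (fn n x)%:E + (n%:R * (b - a))%:E)%E.
  under eq_integral do rewrite EFinD.
  rewrite integralD//; last exact: integrable_cst_itvoo.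
  congr (_ + _)%E; rewrite integral_cst// EFinM; congr (_ * _)%E.
  by have := @lebesgue_measure_itv R `]a, b[; rewrite /= lte_fin ab.
have fnfin : (\int[leb]_(x in `]a, b[) (fn n x)%:E)%E \is a fin_num by exact: integrable_fin_num.
rewrite inth in gint.
have gfin : (\int[leb]_(x in `]a, b[) g x < +oo)%E.
  by rewrite (le_lt_trans gint)// -(fineK fnfin) -!EFinD ltry.
pose GE y := (\int[leb]_(x in `]a, y[) g x)%E.
have GE0 y : (0 <= GE y)%E by apply: integral_ge0.
have GEle y z : y <= z -> (GE y <= GE z)%E.
  move=> yz; apply: ge0_subset_integral => //; first exact: measurable_funTS.
  by apply: subset_itvl; rewrite bnd_simp.
have GEfin y : y <= b -> GE y \is a fin_num.
  by move=> yb; rewrite ge0_fin_numE// (le_lt_trans (GEle _ _ yb)).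
have /= := @increment_le R (fun y => F y + n%:R * y) (fine \o GE) a b (ltW ab).
have -> : GE a = 0%E by rewrite /GE set_itvoo0 integral_set0.
rewrite /= subr0 => H.
have {H} : F b + n%:R * b - (F a + n%:R * a) <= fine (GE b).
  apply: H.
  - move=> x; apply: cvgD; first exact: cF.
    have := @continuous_subspaceT R R `[a, b] ( *%R n%:R); apply.
    exact: mulrl_continuous.
  - move=> y z; rewrite !in_itv/= => /andP[_ yb] /andP[_ zb] yz.
    by rewrite fine_le ?GEfin ?GEle.
  - move=> x e xab e0.
    have ax : a < x by rewrite (itvP xab).
    have xb : x < b by rewrite (itvP xab).
    have [d /= d0 hd] := glsc _ xab.
    near=> y.
    have xy : x < y by near: y; exact: nbhs_right_gt.
    have yb : y < b by near: y; exact: nbhs_right_lt.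
    have yd : y < x + d by near: y; apply: nbhs_right_lt; rewrite ltrDl.
    have hF : F y - F x <= (f x + e) * (y - x).
      by near: y; apply: derive_increment => //; exact: dF.
    have hG : (GE x + ((fn n x + n%:R) * (y - x))%:E <= GE y)%E.
      have -> : GE y = (GE x + \int[leb]_(z in `[x, y[) g z)%E.
        rewrite /GE -ge0_integral_setU//; first last.
        - apply/disj_setPRL => z /=; rewrite !in_itv/= => /andP[xz _].
          by apply/negP; rewrite negb_and -!leNgt xz orbT.
        - exact: measurable_funTS.
        - by rewrite -itv_bndbnd_setU// bnd_simp// ltW.
      apply: leeD2l.
      have -> : ((fn n x + n%:R) * (y - x))%:E = (\int[leb]_(z in `[x, y[) (fn n x + n%:R)%:E)%E.
        rewrite integral_cst// EFinM; congr (_ * _)%E.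
        by have := @lebesgue_measure_itv R `[x, y[; rewrite /= lte_fin xy.
      apply: ge0_le_integral => //.
      - by move=> z _; rewrite lee_fin h0.
      - exact: measurable_funTS.
      - move=> z /=; rewrite in_itv/= => /andP[xz zy]; apply: hd.
        by rewrite /ball_/= distrC ger0_norm ?subr_ge0//; lra.
    have : fine (GE x) + (fn n x + n%:R) * (y - x) <= fine (GE y).
      rewrite -lee_fin EFinD !fineK// GEfin// ltW//.
    have : (f x + e) * (y - x) <= (fn n x + e) * (y - x).
      by rewrite ler_pM2r ?subr_gt0// lerD2r /fn le_max lexx.
    rewrite /=; lra.
rewrite -lee_fin fineK ?GEfin// => H.
have := le_trans H gint.
rewrite -(fineK fnfin) -!EFinD !lee_fin; lra.
Unshelve. all: by end_near. Qed.

Lemma ftc_derive (R : realType) (F f : R -> R) (a b : R) : a < b ->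
  {within `[a, b], continuous F} ->
  (forall x, x \in `]a, b[ -> is_derive x (1 : R) F (f x)) ->
  leb.-integrable `]a, b[ (EFin \o f) ->
  \int[leb]_(x in `]a, b[) f x = F b - F a.
Proof.
move=> ab cF dF intf.
have fin : (\int[leb]_(x in `]a, b[) (f x)%:E)%E \is a fin_num by exact: integrable_fin_num.
apply/eqP; rewrite eq_le; apply/andP; split; last first.
  by rewrite -lee_fin fineK//; exact: ftc_derive_le.
have := @ftc_derive_le R (-%R \o F) (-%R \o f) a b ab.
have -> : (\int[leb]_(x in `]a, b[) ((-%R \o f) x)%:E)%E =
    (- (\int[leb]_(x in `]a, b[) (f x)))%:E.
  under eq_integral do rewrite /= EFinN.
  by rewrite integralN ?fin_num_adde_defr ?EFinN ?fineK// integrable_pos_fin_num.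
rewrite lee_fin /= -opprD lerN2; apply.
- by move=> x; apply: cvgN; exact: cF.
- by move=> x xab; apply: is_deriveN; exact: dF.
- exact: (integrableN intf).
Qed.

(** * Powers and the Gamma function *)

Lemma is_derive_powR (R : realType) (a x : R) : 0 < x ->
  is_derive x (1 : R) (@powR R ^~ a) (a * x `^ (a - 1)).
Proof.
move=> x0; have xI : x \in `]0, +oo[ by rewrite in_itv/= x0.
apply: DeriveDef; first exact: derivable_powR.
by rewrite -derive1E powR_derive1.
Qed.

Lemma is_derive_powR_div (R : realType) (a x : R) : 0 < a -> 0 < x ->
  is_derive x (1 : R) (fun y => y `^ a / a) (x `^ (a - 1)).
Proof.
move=> a0 x0; have dx := @is_derive_powR R a x x0.
have : is_derive x (1 : R) (fun y => a^-1 *: y `^ a) (a^-1 *: (a * x `^ (a - 1))).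
  exact: is_deriveZ.
rewrite /GRing.scale/= mulrA mulVf ?gt_eqF// mul1r.
by under [X in is_derive _ _ X]funext do rewrite mulrC.
Qed.

Lemma continuous_powR_pos (R : realType) (a x : R) : 0 < x ->
  {for x, continuous (@powR R ^~ a)}.
Proof.
move=> x0; have [dx _] := @is_derive_powR R a x x0.
exact/differentiable_continuous/derivable1_diffP.
Qed.

Lemma within_continuous_powR (R : realType) (a T : R) : 0 < a -> 0 < T ->
  {within `[0, T], continuous (@powR R ^~ a)}.
Proof.
move=> a0 T0; apply/(continuous_within_itvP _ T0); split.
- by move=> x xT; apply: continuous_powR_pos; rewrite (itvP xT).
- by rewrite powR0 ?gt_eqF//; exact: powR_cvg0.
- exact/cvg_at_left_filter/continuous_powR_pos.
Qed.

(** For [a < 1] the integrand is unbounded at 0. The primitive bounds the integrals over []1 / (n +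
    1), T[] by [T ^ a / a], and monotone convergence passes to []0, T[]. *)
Lemma integrable_powR (R : realType) (a T : R) : 0 < a ->
  leb.-integrable `]0, T[ (EFin \o @powR R ^~ (a - 1)).
Proof.
move=> a0; have [T0|T0] := ltP 0 T; last first.
  by rewrite set_itv_ge ?bnd_simp -?leNgt//; exact: integrable_set0.
have mp : measurable_fun setT (EFin \o (@powR R ^~ (a - 1) : R -> R)).
  by apply/measurable_EFinP; exact: measurable_powR.
apply/integrableP; split; first exact: measurable_funTS.
have -> : (\int[leb]_(x in `]0%R, T[) `|(EFin \o (@powR R ^~ (a - 1)%R)) x| =
    \int[leb]_(x in `]0%R, T[) (x `^ (a - 1))%R%:E)%E.
  by apply: eq_integral => x _; rewrite /= ger0_norm// powR_ge0.
pose F (n : nat) : set R := `]n.+1%:R^-1, T[%classic.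
have UF : `]0, T[%classic = \bigcup_n F n.
  apply/seteqP; split=> [x|x [n _]]; rewrite /F/= !in_itv/= => /andP[x0 xT]; last first.
    by rewrite xT (lt_trans _ x0)//.
  have [n nx] := ltr_add_invr x0.
  by exists n => //=; rewrite in_itv/= xT add0r in nx *; rewrite nx.
have cvgF : (\int[leb]_(x in F n) (x `^ (a - 1))%R%:E @[n --> \oo] -->
    \int[leb]_(x in `]0%R, T[) (x `^ (a - 1))%R%:E)%E.
  rewrite UF; apply: ge0_nondecreasing_set_cvg_integral => //.
  - apply/nondecreasing_seqP => n; apply/subsetPset; apply: subset_itvr.
    by rewrite bnd_simp lef_pV2 ?posrE// ler_nat.
  - by move=> n; exact: measurable_itv.
  - by move=> n; exact: measurable_funTS.
  - by move=> n x _; rewrite lee_fin powR_ge0.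
apply: (@le_lt_trans _ _ (T `^ a / a)%:E); last by rewrite ltry.
apply: cvge_to_le cvgF _; apply: nearW => n.
have [nT|nT] := ltP n.+1%:R^-1 T; last first.
  by rewrite /F set_itv_ge ?bnd_simp -?leNgt// integral_set0 lee_fin divr_ge0 ?powR_ge0// ltW.
have n0 : 0 < n.+1%:R^-1 :> R by [].
have ci : {within `[n.+1%:R^-1, T], continuous (@powR R ^~ (a - 1))}.
  apply: continuous_in_subspaceT => x; rewrite inE/= in_itv/= => /andP[nx _].
  by apply: continuous_powR_pos; rewrite (lt_le_trans n0).
have ifn : leb.-integrable (F n) (EFin \o @powR R ^~ (a - 1)).
  apply: (@integrableS _ _ _ leb `[n.+1%:R^-1, T]) => //.
    exact: measurable_itv.
    exact: subset_itv_oo_cc.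
  by apply: continuous_compact_integrable => //; exact: segment_compact.
rewrite /F in ifn *.
have cF : {within `[n.+1%:R^-1, T], continuous (fun x => x `^ a / a)}.
  move=> x; apply: cvgM; last exact: cvg_cst.
  have := @continuous_in_subspaceT R R `[n.+1%:R^-1, T] (@powR R ^~ a); apply.
  move=> y; rewrite inE/= in_itv/= => /andP[ny _].
  by apply: continuous_powR_pos; rewrite (lt_le_trans n0).
have dF x : x \in `]n.+1%:R^-1, T[ -> is_derive x (1 : R) (fun x => x `^ a / a) (x `^ (a - 1)).
  by move=> xI; apply: is_derive_powR_div => //; rewrite (lt_trans n0)// (itvP xI).
have := ftc_derive nT cF dF ifn; rewrite /Rintegral => H.
rewrite -[leLHS]fineK ?lee_fin; last exact: integrable_fin_num.
by rewrite H lerBlDr lerDl divr_ge0 ?powR_ge0// ltW.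
Qed.

Lemma integral_powR (R : realType) (a T : R) : 0 < a -> 0 < T ->
  \int[leb]_(x in `]0, T[) x `^ (a - 1) = T `^ a / a.
Proof.
move=> a0 T0.
have cF : {within `[0, T], continuous (fun x => x `^ a / a)}.
  by move=> x; apply: cvgM; [apply: within_continuous_powR|exact: cvg_cst].
have dF x : x \in `]0, T[ -> is_derive x (1 : R) (fun x => x `^ a / a) (x `^ (a - 1)).
  by move=> xI; apply: is_derive_powR_div => //; rewrite (itvP xI).
rewrite (ftc_derive T0 cF dF) ?powR0 ?gt_eqF ?mul0r ?subr0//.
exact: integrable_powR.
Qed.

Definition gamma_integrand (R : realType) (a t : R) : R := t `^ (a - 1) * expR (- t).

Lemma gamma_integrand_ge0 (R : realType) (a t : R) : 0 <= gamma_integrand a t.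
Proof. by rewrite mulr_ge0 ?powR_ge0 ?expR_ge0. Qed.

Lemma measurable_gamma_integrand (R : realType) (a : R) :
  measurable_fun setT (gamma_integrand a).
Proof.
apply: measurable_funM; first exact: measurable_powR.
by apply: measurableT_comp; [exact: measurable_expR|exact: oppr_measurable].
Qed.

Lemma gamma_integrand_tail (R : realType) (a : R) :
  exists C : R, 0 <= C /\ forall t, 1 <= t -> gamma_integrand a t <= C * exponential_pdf (1 / 2) t.
Proof.
pose m := (Num.trunc (`|a|)).+1.
have am : a - 1 <= m%:R.
  have /truncn_itv/andP[_] := normr_ge0 a.
  rewrite -/m; have := ler_norm a; lra.
(* From [1 + x <= expR x] at [x = t / (2 m)], raised to the power [m]; the last factor 2 cancels the
   1 / 2 in front of the exponential density. *)
exists ((2 * m%:R) ^+ m * 2); split; first by rewrite mulr_ge0// exprn_ge0// mulr_ge0.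
move=> t t1; have t0 : 0 <= t by rewrite (le_trans _ t1).
rewrite exponential_pdfE//.
have m0 : 0 < 2 * m%:R :> R by rewrite mulr_gt0.
have key : t ^+ m <= (2 * m%:R) ^+ m * expR (t / 2).
  have -> : expR (t / 2) = expR (t / (2 * m%:R)) ^+ m.
    by rewrite -expRM_natl; congr expR; field; rewrite pnatr_eq0.
  rewrite -exprMn lerXn2r// ?nnegrE ?mulr_ge0 ?expR_ge0 ?(ltW m0)//.
  rewrite -ler_pdivrMl// mulrC (le_trans _ (expR_ge1Dx _))// lerDr//.
apply: (@le_trans _ _ (t ^+ m * expR (- t))).
  rewrite ler_wpM2r ?expR_ge0// -powR_mulrn//; exact: ler_powR.
apply: (@le_trans _ _ ((2 * m%:R) ^+ m * expR (t / 2) * expR (- t))).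
  by rewrite ler_wpM2r ?expR_ge0.
rewrite -mulrA -expRD (_ : t / 2 - t = - (1 / 2) * t); last by field.
by rewrite le_eqVlt; apply/orP; left; apply/eqP; field.
Qed.

Lemma integrable_gamma (R : realType) (a : R) : 0 < a ->
  leb.-integrable `]0, +oo[ (EFin \o gamma_integrand a).
Proof.
move=> a0; have [C [C0 hC]] := gamma_integrand_tail a.
pose g t := (powR (R:=R) ^~ (a - 1) \_ `]0, 1[) t + C * exponential_pdf (1 / 2) t.
have ig : leb.-integrable setT (EFin \o g).
  rewrite (_ : EFin \o g = (EFin \o (@powR R ^~ (a - 1) \_ `]0, 1[)) \+
      (fun t => C%:E * (EFin \o exponential_pdf (1 / 2)) t)%E); last first.
    by apply/funext => t; rewrite /g /= EFinD EFinM.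
  apply: integrableD => //.
    rewrite -restrict_EFin; apply/integrable_restrict => //.
    by rewrite setTI; exact: integrable_powR.
  by apply: integrableZl => //; exact: integrable_exponential_pdf.
apply: (@le_integrable _ _ _ leb _ _ _ (EFin \o g)) => //.
- by apply/measurable_EFinP/measurable_funTS; exact: measurable_gamma_integrand.
- move=> t /=; rewrite in_itv/= andbT => t0; rewrite lee_fin ger0_norm ?gamma_integrand_ge0//.
  rewrite (le_trans _ (ler_norm _))// /g patchE.
  have [t1|t1] := ltP t 1.
    rewrite mem_set/= ?in_itv/= ?t0// ler_wpDr ?mulr_ge0 ?exponential_pdf_ge0//.
    rewrite ler_piMr ?powR_ge0// -expR0 ler_expR; lra.
  rewrite ifF ?add0r ?hC//; apply/negbTE/negP => /set_mem/=.
  by rewrite in_itv/= => /andP[_]; rewrite ltNge t1.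
- by apply: integrableS ig.
Qed.

Lemma Gamma_gt0 (R : realType) (a : R) : 0 < a -> 0 < Gamma a.
Proof.
move=> a0; have ig := integrable_gamma a0.
rewrite lt_neqAle; apply/andP; split; last first.
  by apply: Rintegral_ge0 => t _; exact: gamma_integrand_ge0.
apply/negP => /eqP G0.
have G0E : (\int[leb]_(t in `]0%R, +oo[) `|(EFin \o gamma_integrand a) t| = 0)%E.
  transitivity (\int[leb]_(t in `]0%R, +oo[) (gamma_integrand a t)%:E)%E.
    by apply: eq_integral => t _ /=; rewrite ger0_norm// gamma_integrand_ge0.
  rewrite -[LHS]fineK; last exact: integrable_fin_num.
  by rewrite [RHS](_ : _ = (Gamma a)%:E)// -G0.
move: G0E => /ae_eq_integral_abs => /(_ (measurable_itv _)) [].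
  by apply/measurable_EFinP/measurable_funTS; exact: measurable_gamma_integrand.
move=> N [mN N0 sub].
have : (leb `](0:R)%R, (1:R)%R[%classic <= leb N)%E.
  apply: leb_le => // t /= tI; apply: sub => /=.
  move=> H; have : gamma_integrand a t = 0.
    by apply: EFin_inj; apply: H; rewrite /= in_itv/= (itvP tI).
  by apply/eqP; rewrite gt_eqF// mulr_gt0 ?expR_gt0 ?powR_gt0// (itvP tI).
by rewrite N0 lebesgue_measure_itv/= lte_fin ltr01 -EFinB lee_fin subr0 ler10.
Qed.

Lemma Gamma1 (R : realType) : Gamma (1 : R) = 1.
Proof.
have H : (\int[leb]_t (exponential_pdf (1 : R) t)%:E = 1)%E by exact: integral_exponential_pdf.
have : (\int[leb]_(t in `[0%R, +oo[) (gamma_integrand (1 : R) t)%:E = 1)%E.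
  transitivity (\int[leb]_t (exponential_pdf (1 : R) t)%:E)%E; last exact: H.
  rewrite [RHS](_ : _ = \int[leb]_t ((EFin \o (fun x : R => 1 * expR (- 1 * x))%R) \_ `[0%R, +oo[) t)%E; last first.
    by apply: eq_integral => t _; rewrite restrict_EFin.
  rewrite -integral_mkcond; apply: eq_integral => t _.
  by rewrite /gamma_integrand /= subrr powRr0 !mul1r mulN1r.
rewrite /Gamma Rintegral_itv_obnd_cbnd; last exact: integrable_gamma.
by rewrite /Rintegral => ->.
Qed.

(** * Fractional integrals *)

(** The image of Lebesgue measure under the affine map, multiplied by [c], has the right value on
    half-open intervals, so uniqueness applies. *)
Lemma lebesgue_measure_affine (R : realType) (c d : R) (A : set R) : 0 < c -> measurable A ->
  leb A = (c%:E * leb ((fun x => c * x + d)%R @^-1` A))%E.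
Proof.
move=> c0 mA.
have mphi : measurable_fun setT
    ((fun x : R => c * x + d) : measurableTypeR R -> measurableTypeR R).
  by apply: measurable_funD => //; exact: measurable_funM.
pose phi : measurableTypeR R -> measurableTypeR R := fun x : R => c * x + d.
unshelve epose (nu := (mscale (NngNum (ltW c0)) (pushforward leb phi) : measure (measurableTypeR R) R)).
  exact: mphi.
have := @lebesgue_measure_unique R nu.
move=> /(_ _ A mA) H; rewrite H// => X [[a b] _ <-].
change (leb `]a, b]%classic = c%:E * leb (phi @^-1` `]a, b]%classic))%E.
have -> : phi @^-1` `]a, b] = `](a - d) / c, (b - d) / c]%classic.
  apply/seteqP; split => x /=; rewrite !in_itv/= /phi ltr_pdivrMr// ler_pdivlMr// (mulrC x);
    by move=> /andP[h1 h2]; apply/andP; split; lra.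
rewrite !lebesgue_measure_itv/= !lte_fin ltr_pM2r ?invr_gt0// ltrD2r.
case: ifPn => _; last by rewrite mule0.
by rewrite -!EFinD -EFinM; congr EFin; field; rewrite gt_eqF.
Qed.

Lemma integral_affine (R : realType) (c d : R) (f : R -> \bar R) : 0 < c ->
  measurable_fun setT f -> (forall x, 0 <= f x)%E ->
  (\int[leb]_x f x = c%:E * \int[leb]_x f (c * x + d)%R)%E.
Proof.
move=> c0 mf f0.
have mphi : measurable_fun setT
    ((fun x : R => c * x + d) : measurableTypeR R -> measurableTypeR R).
  by apply: measurable_funD => //; exact: measurable_funM.
pose phi : measurableTypeR R -> measurableTypeR R := fun x : R => c * x + d.
unshelve epose (nu := (mscale (NngNum (ltW c0)) (pushforward leb phi) : measure (measurableTypeR R) R)).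
  exact: mphi.
rewrite (@eq_measure_integral _ _ R setT nu leb); last first.
  by move=> A mA _; exact: lebesgue_measure_affine.
rewrite ge0_integral_mscale//; congr (_ * _)%E.
by rewrite (ge0_integral_pushforward mphi).
Qed.

Lemma integral_opp (R : realType) (f : R -> \bar R) :
  measurable_fun setT f -> (forall x, 0 <= f x)%E ->
  (\int[leb]_x f x = \int[leb]_x f (- x)%R)%E.
Proof.
move=> mf f0.
have mo : measurable_fun setT (-%R : measurableTypeR R -> measurableTypeR R) by exact: oppr_measurable.
rewrite (@eq_measure_integral _ _ R setT (pushforward leb (-%R : _ -> measurableTypeR R)) leb); last first.
  by move=> A mA _; exact/esym/lebesgue_measureN.
by rewrite (ge0_integral_pushforward mo).
Qed.

Lemma integral_reflect (R : realType) (t : R) (f : R -> \bar R) :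
  measurable_fun setT f -> (forall x, 0 <= f x)%E ->
  (\int[leb]_x f x = \int[leb]_x f (t - x)%R)%E.
Proof.
move=> mf f0; rewrite (@integral_affine _ 1 t)// mul1e integral_opp//.
  by apply: eq_integral => x _; rewrite mul1r addrC.
apply: measurableT_comp => //; apply: measurable_funD => //; exact: measurable_funM.
Qed.

(** Zero for [s <= 0], so that a convolution over []0, t[] is an integral over the whole line, to
    which translation, scaling and Tonelli apply directly. In particular [kern 1 0 = 0]. *)
Definition kern (R : realType) (a s : R) : R :=
  if 0 < s then s `^ (a - 1) / Gamma a else 0.

Section kern.
Context {R : realType}.
Implicit Types a b c s t : R.

Lemma kern_pos a s : 0 < s -> kern a s = s `^ (a - 1) / Gamma a.
Proof. by rewrite /kern => ->. Qed.

Lemma kern_neg a s : s <= 0 -> kern a s = 0.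
Proof. by rewrite /kern leNgt => /negbTE ->. Qed.

Lemma kern_ge0 a s : 0 < a -> 0 <= kern a s.
Proof.
move=> a0; rewrite /kern; case: ifP => // _.
by rewrite divr_ge0 ?powR_ge0// ltW// Gamma_gt0.
Qed.

Lemma kern_gt0 a s : 0 < a -> 0 < s -> 0 < kern a s.
Proof. by move=> a0 s0; rewrite kern_pos// divr_gt0 ?powR_gt0// Gamma_gt0. Qed.

Lemma kern1 s : 0 < s -> kern 1 s = 1.
Proof. by move=> s0; rewrite kern_pos// subrr powRr0 Gamma1 divr1. Qed.

Lemma measurable_kern a : measurable_fun setT (kern a).
Proof.
apply: measurable_fun_ifT => //.
  exact: measurable_fun_ltr.
by apply: measurable_funM => //; exact: measurable_powR.
Qed.

Lemma kern_scale a c s : 0 < c -> kern a (c * s) = c `^ (a - 1) * kern a s.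
Proof.
move=> c0; have [s0|s0] := ltP 0 s; last first.
  by rewrite !kern_neg ?mulr0// pmulr_rle0.
by rewrite !kern_pos ?mulr_gt0// powRM ?ltW// mulrA.
Qed.

Lemma kern_laplace1 a : 0 < a -> (\int[leb]_t (kern a t * expR (- t))%:E = 1)%E.
Proof.
move=> a0; have ig := integrable_gamma a0.
transitivity (\int[leb]_t ((fun t => (Gamma a)^-1%:E * (gamma_integrand a t)%:E) \_ `](0 : R)%R, +oo[) t)%E.
  apply: eq_integral => t _; rewrite patchE.
  have [t0|t0] := ltP 0 t.
    rewrite mem_set/= ?in_itv/= ?t0// -EFinM kern_pos// /gamma_integrand.
    by congr EFin; ring.
  rewrite kern_neg// mul0r ifF//; apply/negbTE/negP => /set_mem/=.
  by rewrite in_itv/= andbT ltNge t0.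
rewrite -integral_mkcond integralZl//.
rewrite -[X in (_ * X)%E]fineK; last exact: integrable_fin_num.
by rewrite -EFinM -[X in _ * X]/(Gamma a) mulVf// gt_eqF// Gamma_gt0.
Qed.

Lemma measurable_kern_expR a c : measurable_fun setT (fun t => (kern a t * expR (- (c * t)))%:E).
Proof.
apply/measurable_EFinP; apply: measurable_funM; first exact: measurable_kern.
apply: measurableT_comp; first exact: measurable_expR.
by apply: measurableT_comp; [exact: oppr_measurable|exact: measurable_funM].
Qed.

Lemma kern_laplace a c : 0 < a -> 0 < c ->
  (\int[leb]_t (kern a t * expR (- (c * t)))%:E = (c `^ (- a))%:E)%E.
Proof.
move=> a0 c0; have := kern_laplace1 a0.
have m1 : measurable_fun setT (fun t => (kern a t * expR (- t))%:E).
  by have := @measurable_kern_expR a 1; under eq_fun do rewrite mul1r.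
rewrite (integral_affine 0 c0)//; last first.
  by move=> x; rewrite lee_fin mulr_ge0 ?kern_ge0 ?expR_ge0.
under eq_integral do rewrite addr0 kern_scale// -mulrA EFinM.
rewrite ge0_integralZl_EFin ?powR_ge0//; last exact: measurable_kern_expR.
  rewrite muleA -EFinM mulr_powRB1// ?ltW// => H.
  have ca : c `^ a != 0 by rewrite gt_eqF ?powR_gt0.
  by rewrite -[LHS]mul1e powRN -(mulVf ca) EFinM -muleA H mule1.
by move=> x _; rewrite lee_fin mulr_ge0 ?kern_ge0 ?expR_ge0.
Qed.

Lemma measurable_kernB a : measurable_fun setT (fun z : R * R => kern a (z.1 - z.2)).
Proof.
apply: measurableT_comp; first exact: measurable_kern.
exact: measurable_funB.
Qed.

(* [kern a * kern b] is homogeneous of degree [a + b - 1] by scaling; the constant is found by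
   comparing Laplace transforms at 1. *)
Lemma kern_conv a b t : 0 < a -> 0 < b ->
  (\int[leb]_s (kern a (t - s) * kern b s)%:E = (kern (a + b) t)%:E)%E.
Proof.
move=> a0 b0.
have ab0 : 0 < a + b by rewrite addr_gt0.
have mk u : measurable_fun setT (fun s => (kern a (u - s) * kern b s)%:E).
  apply/measurable_EFinP; apply: measurable_funM; last exact: measurable_kern.
  by apply: measurableT_comp; [exact: measurable_kern|exact: measurable_funB].
have k0 u s : (0 <= (kern a (u - s) * kern b s)%:E)%E by rewrite lee_fin mulr_ge0 ?kern_ge0.
have cneg u : u <= 0 -> (\int[leb]_s (kern a (u - s) * kern b s)%:E = 0)%E.
  move=> u0; apply: integral0_eq => s _.
  have [s0|s0] := ltP 0 s; last by rewrite [kern b _]kern_neg// mulr0.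
  by rewrite kern_neg ?mul0r// subr_le0 (le_trans u0)// ltW.
set B := (\int[leb]_s (kern a (1 - s) * kern b s)%:E)%E.
have B0 : (0 <= B)%E by apply: integral_ge0.
have hom u : 0 < u ->
    (\int[leb]_s (kern a (u - s) * kern b s)%:E = (u `^ (a + b - 1))%:E * B)%E.
  move=> u0; rewrite (integral_affine 0 u0 (mk u) (k0 u)).
  have -> : (\int[leb]_s (kern a (u - (u * s + 0)) * kern b (u * s + 0))%R%:E =
      \int[leb]_s ((u `^ (a - 1) * u `^ (b - 1))%R%:E * (kern a (1 - s)%R * kern b s)%R%:E))%E.
    apply: eq_integral => s _; rewrite addr0.
    have -> : u - u * s = u * (1 - s) by ring.
    by rewrite (kern_scale a _ u0) (kern_scale b _ u0) -EFinM mulrACA.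
  rewrite ge0_integralZl_EFin//; last 2 first.
  - exact: mk.
  - by rewrite mulr_ge0 ?powR_ge0.
  rewrite muleA -EFinM mulrA mulr_powRB1 ?(ltW u0)// -powRD ?addrA//.
  by apply/implyP => _; rewrite gt_eqF.
have HL : (\int[leb]_u ((\int[leb]_s (kern a (u - s) * kern b s)%:E) * (expR (- u))%:E) =
    (Gamma (a + b))%:E * B)%E.
  transitivity (\int[leb]_u ((B * (Gamma (a + b))%:E) * (kern (a + b) u * expR (- u))%:E))%E.
    apply: eq_integral => u _; have [u0|u0] := ltP 0 u; last first.
      by rewrite cneg// kern_neg// !mul0r mul0e mule0.
    rewrite hom// kern_pos// muleAC -EFinM -[RHS]muleA [RHS]muleC -EFinM.
    by congr (_%:E * _)%E; field; rewrite gt_eqF// Gamma_gt0.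
  rewrite ge0_integralZl//.
  - by rewrite kern_laplace1// mule1 muleC.
  - by have := @measurable_kern_expR (a + b) 1; under eq_fun do rewrite mul1r.
  - by move=> u _; rewrite lee_fin mulr_ge0 ?kern_ge0 ?expR_ge0.
  - by rewrite mule_ge0// lee_fin ltW// Gamma_gt0.
(* The same Laplace transform by Tonelli and translation by [s]: the product of the transforms of
   the two kernels, which are both 1 at 1. *)
have HR : (\int[leb]_u ((\int[leb]_s (kern a (u - s) * kern b s)%:E) * (expR (- u))%:E) = 1)%E.
  have me : measurable_fun setT (fun u : R => expR (- u)).
    by apply: measurableT_comp; [exact: measurable_expR|exact: oppr_measurable].
  pose K (z : R * R) := (kern a (z.1 - z.2) * kern b z.2 * expR (- z.1))%:E.
  have mK : measurable_fun setT (fun z : R * R => kern a (z.1 - z.2) * kern b z.2 * expR (- z.1)).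
    apply: measurable_funM.
      apply: measurable_funM; first exact: measurable_kernB.
      by apply: measurableT_comp; [exact: measurable_kern|exact: measurable_snd].
    exact: (measurableT_comp me measurable_fst).
  transitivity (\int[leb]_u \int[leb]_s K (u, s))%E.
    by apply: eq_integral => u _; rewrite -ge0_integralZr ?lee_fin ?expR_ge0//; exact: mk.
  rewrite fubini_tonelli; last 2 first.
  - by apply/measurable_EFinP; exact: mK.
  - by move=> z; rewrite lee_fin !mulr_ge0 ?kern_ge0 ?expR_ge0.
  rewrite -[RHS](kern_laplace1 b0); apply: eq_integral => s _.
  rewrite (integral_affine s ltr01); last 2 first.
  - have mKs : measurable_fun setT (fun u : R => kern a (u - s) * kern b s * expR (- u)).
      apply: measurable_funM => //; apply: measurable_funM => //.
      by apply: measurableT_comp; [exact: measurable_kern|exact: measurable_funB].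
    by apply/measurable_EFinP; exact: mKs.
  - by move=> u; rewrite lee_fin !mulr_ge0 ?kern_ge0 ?expR_ge0.
  rewrite mul1e -[RHS]mule1 -(kern_laplace1 a0) -ge0_integralZl_EFin//; last 3 first.
  - by move=> u _; rewrite lee_fin mulr_ge0 ?kern_ge0 ?expR_ge0.
  - by have := @measurable_kern_expR a 1; under eq_fun do rewrite mul1r.
  - by rewrite mulr_ge0 ?kern_ge0 ?expR_ge0.
  apply: eq_integral => u _; rewrite /K/= mul1r addrK opprD expRD -EFinM.
  by move: (kern a u) (kern b s) (expR (- u)) (expR (- s)) => x1 x2 x3 x4; congr EFin; ring.
rewrite HL in HR.
(* Euler's Beta integral, divided by [Gamma a * Gamma b]. *)
have BE : B = ((Gamma (a + b))^-1)%:E.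
  have G0 : Gamma (a + b) != 0 by rewrite gt_eqF// Gamma_gt0.
  by rewrite -[LHS]mul1e -(mulVf G0) EFinM -muleA HR mule1.
have [t0|t0] := ltP 0 t; first by rewrite hom// BE kern_pos.
by rewrite cneg// kern_neg.
Qed.

End kern.

Definition frac (R : realType) (a : R) (f : R -> R) (t : R) : R :=
  \int[leb]_(s in `]0, t[) (kern a (t - s) * f s).

Lemma fracE (R : realType) (a : R) (f : R -> R) (t : R) :
  frac a f t = \int[leb]_(s in `]0, t[) (kern a (t - s) * f s).
Proof. by []. Qed.

Section frac.
Context {R : realType}.
Implicit Types (a b c s t : R) (f g : R -> R).

Lemma kern_conv_restrict a b t :
  (fun s => (kern a (t - s)%R * kern b s)%R%:E) =
  (fun s => (kern a (t - s)%R * kern b s)%R%:E) \_ `]0, t[.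
Proof.
apply/funext => s; rewrite patchE; case: ifPn => // /negP sI.
have [s0|s0] := ltP 0 s; last by rewrite [kern b _]kern_neg// mulr0.
rewrite kern_neg ?mul0r// subr_le0 leNgt; apply/negP => st.
by apply: sI; rewrite inE/= in_itv/= s0.
Qed.

Lemma measurable_kern_sub a t : measurable_fun setT (fun s => kern a (t - s)).
Proof. by apply: measurableT_comp; [exact: measurable_kern|exact: measurable_funB]. Qed.

Lemma kern_conv_itv a b t : 0 < a -> 0 < b ->
  (\int[leb]_(s in `]0%R, t[) (kern a (t - s)%R * kern b s)%R%:E = (kern (a + b)%R t)%:E)%E.
Proof. by move=> a0 b0; rewrite -(kern_conv t a0 b0) integral_mkcond -kern_conv_restrict. Qed.

Lemma integrable_kern_conv a b t : 0 < a -> 0 < b ->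
  leb.-integrable `]0, t[ (fun s => (kern a (t - s)%R * kern b s)%R%:E).
Proof.
move=> a0 b0; apply/integrableP; split.
  apply/measurable_EFinP; apply: measurable_funTS; apply: measurable_funM.
    exact: measurable_kern_sub.
  exact: measurable_kern.
have <- : (\int[leb]_(s in `]0%R, t[) (kern a (t - s)%R * kern b s)%R%:E =
    \int[leb]_(s in `]0%R, t[) `|(kern a (t - s)%R * kern b s)%R%:E|)%E; last first.
  by rewrite kern_conv_itv// ltry.
by apply: eq_integral => s _; rewrite /= ger0_norm// mulr_ge0 ?kern_ge0.
Qed.

Lemma frac_kern a b t : 0 < a -> 0 < b -> frac a (kern b) t = kern (a + b) t.
Proof. by move=> a0 b0; rewrite /frac /Rintegral kern_conv_itv. Qed.

Lemma eq_frac a f g t : {in `]0, t[, f =1 g} -> frac a f t = frac a g t.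
Proof. by move=> fg; apply: eq_Rintegral => s /set_mem sI; rewrite fg. Qed.

Lemma frac1 f t : frac 1 f t = \int[leb]_(s in `]0, t[) f s.
Proof.
apply: eq_Rintegral => s /set_mem/=; rewrite in_itv/= => /andP[s0 st].
by rewrite kern1 ?mul1r// subr_gt0.
Qed.

(** The functional equation is the convolution law for [kern 1] and [kern a], evaluated at 1, where
    the left side is the integral of a power. *)
Lemma GammaD1 a : 0 < a -> Gamma (a + 1) = a * Gamma a.
Proof.
move=> a0; have G0 := Gamma_gt0 a0; have a10 : 0 < a + 1 by rewrite addr_gt0.
have := frac_kern 1 (ltr01 : 0 < 1 :> R) a0.
rewrite frac1 [1 + a]addrC kern_pos// powR1 mul1r => H.
suff : (Gamma (a + 1))^-1 = (a * Gamma a)^-1 by move=> /invr_inj.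
rewrite -H (_ : \int[leb]_(s in `]0, 1[) kern a s = \int[leb]_(s in `]0, 1[) (s `^ (a - 1) * (Gamma a)^-1)).
  rewrite RintegralZr//; last exact: integrable_powR.
  by rewrite integral_powR// powR1 mul1r invfM.
by apply: eq_Rintegral => s /set_mem/= sI; rewrite kern_pos// (itvP sI).
Qed.

(** The contribution of []c, c + 1[] alone. Since [c] is free, [Gamma] outgrows every geometric
    sequence, which later gives the kernel series an infinite radius of convergence. *)
Lemma Gamma_ge a c : 0 <= a -> 0 < c -> c `^ a * expR (- (c + 1)) <= Gamma (a + 1).
Proof.
move=> a0 c0; have a10 : 0 < a + 1 by rewrite ltr_wpDl.
have ig := integrable_gamma a10.
rewrite -lee_fin.
have -> : ((Gamma (a + 1))%:E = \int[leb]_(t in `]0%R, +oo[) (gamma_integrand (a + 1)%R t)%:E)%E.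
  by rewrite /Gamma /Rintegral fineK//; exact: integrable_fin_num.
apply: (@le_trans _ _ (\int[leb]_(t in `]c, (c + 1)%R[) (gamma_integrand (a + 1)%R t)%:E)%E); last first.
  apply: ge0_subset_integral => //.
  - by apply/measurable_EFinP/measurable_funTS; exact: measurable_gamma_integrand.
  - by move=> t _; rewrite lee_fin gamma_integrand_ge0.
  - by move=> t /=; rewrite !in_itv/= andbT => /andP[ct _]; rewrite (lt_trans c0).
apply: (@le_trans _ _ (\int[leb]_(t in `]c, (c + 1)%R[) (c `^ a * expR (- (c + 1)))%R%:E)%E).
  rewrite integral_cst// [X in (_ * X)%E](_ : _ = 1%:E) ?mule1//.
  have := @lebesgue_measure_itv R `]c, c + 1[; rewrite /= lte_fin ltrDl ltr01 => ->.
  by rewrite -EFinD; congr EFin; ring.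
apply: ge0_le_integral => //.
- by move=> t _; rewrite lee_fin mulr_ge0 ?powR_ge0 ?expR_ge0.
- by apply/measurable_EFinP/measurable_funTS; exact: measurable_gamma_integrand.
- move=> t /=; rewrite in_itv/= => /andP[ct tc]; rewrite lee_fin /gamma_integrand addrK.
  rewrite ler_pM ?powR_ge0 ?expR_ge0//.
    by rewrite ge0_ler_powR// ?nnegrE ?ltW// (lt_trans c0).
  by rewrite ler_expR lerN2 ltW.
Qed.

End frac.

(** * The semigroup law of fractional integrals *)

Lemma restrictP (R : realType) (f : R -> R) (a b x : R) :
  (f \_ `]a, b[) x = if (a < x) && (x < b) then f x else 0.
Proof.
rewrite patchE (_ : (x \in _) = (a < x) && (x < b))//.
by apply/idP/idP => [/set_mem/=|h]; [|apply/mem_set => /=]; rewrite in_itv.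
Qed.

Lemma kern_le (R : realType) (a s t : R) : 1 <= a -> s <= t -> 0 <= t ->
  kern a s <= t `^ (a - 1) / Gamma a.
Proof.
move=> a1 st t0; have a0 : 0 < a by rewrite (lt_le_trans ltr01).
have [s0|s0] := ltP 0 s; last by rewrite kern_neg// divr_ge0 ?powR_ge0// ltW// Gamma_gt0.
rewrite kern_pos// ler_pM2r ?invr_gt0 ?Gamma_gt0//.
by rewrite ge0_ler_powR// ?nnegrE ?subr_ge0// ltW.
Qed.

Section frac_comp.
Context {R : realType}.
Variables (f : R -> R) (t : R).
Hypothesis t0 : 0 < t.
Hypothesis intf : leb.-integrable `]0, t[ (EFin \o f).

Let g := f \_ `]0, t[.

Let ig : leb.-integrable setT (EFin \o g).
Proof. by rewrite /g -restrict_EFin; apply/integrable_restrict => //; rewrite setTI. Qed.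

Let mg : measurable_fun setT g.
Proof. by apply/measurable_EFinP; exact: measurable_int ig. Qed.

Let measurable_kern_snd (b : R) :
  measurable_fun setT (fun z : R * R => kern b (z.1 - z.2) * g z.2).
Proof.
apply: measurable_funM; first exact: measurable_kernB.
exact: (measurableT_comp mg measurable_snd).
Qed.

Let H (b s : R) := (\int[leb]_r (kern b (s - r) * g r)%:E)%E.

Let measurable_H (b : R) : measurable_fun setT (H b).
Proof.
have mK := measurable_kern_snd b.
pose K (z : R * R) := (kern b (z.1 - z.2) * g z.2)%:E.
have mK' : measurable_fun setT K by apply/measurable_EFinP; exact: mK.
rewrite (_ : H b = (fun s => fubini_F leb (K^\+)%E s - fubini_F leb (K^\-)%E s)%E); last first.
  apply/funext => s; rewrite /H [LHS]integralE; congr (_ - _)%E.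
    by apply: eq_integral => r _; rewrite !funeposE.
  by apply: eq_integral => r _; rewrite !funenegE.
apply: emeasurable_funB.
- apply: (@measurable_fun_fubini_tonelli_F _ _ _ _ R leb (K^\+)%E).
    by apply: measurable_funepos; exact: mK'.
  by move=> z; exact: funepos_ge0.
- apply: (@measurable_fun_fubini_tonelli_F _ _ _ _ R leb (K^\-)%E).
    by apply: measurable_funeneg; exact: mK'.
  by move=> z; exact: funeneg_ge0.
Qed.

Let frac_H (b s : R) : s < t -> frac b f s = fine (H b s).
Proof.
move=> st; rewrite /frac Rintegral_mkcond /H; congr fine.
apply: eq_integral => r _; rewrite restrictP /g restrictP.
have [r0|r0] := ltP 0 r => /=; last by rewrite mulr0.
have [rs|sr] := ltP r s; first by rewrite (lt_trans rs st).
by rewrite kern_neg ?mul0r// subr_le0.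
Qed.

Lemma measurable_frac (b : R) : measurable_fun `]0, t[ (frac b f).
Proof.
apply: (eq_measurable_fun (fine \o H b)).
  by move=> s /set_mem/=; rewrite in_itv/= => /andP[_ st]; rewrite frac_H.
apply: measurable_funTS; apply: measurableT_comp; last exact: measurable_H.
exact: fine_measurable.
Qed.

Variables (a b : R).
Hypotheses (a0 : 0 < a) (b0 : 0 < b) (ab1 : 1 <= a + b).

Let Phi (z : R * R) := (kern a (t - z.1) * (kern b (z.1 - z.2) * g z.2))%:E.

Let measurable_Phi : measurable_fun setT Phi.
Proof.
apply/measurable_EFinP; apply: measurable_funM; last exact: measurable_kern_snd.
exact: (measurableT_comp (measurable_kern_sub a t) measurable_fst).
Qed.

Let integral_kern_kern (r : R) :
  (\int[leb]_s (kern a (t - s) * kern b (s - r))%:E = (kern (a + b) (t - r))%:E)%E.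
Proof.
rewrite -(kern_conv (t - r) a0 b0) (integral_affine r ltr01); last 2 first.
- apply/measurable_EFinP; apply: measurable_funM; first exact: measurable_kern_sub.
  by apply: measurableT_comp; [exact: measurable_kern|exact: measurable_funB].
- by move=> s; rewrite lee_fin mulr_ge0 ?kern_ge0.
rewrite mul1e; apply: eq_integral => s _.
by rewrite mul1r addrK opprD addrA addrAC.
Qed.

Let measurable_kern_kern (r : R) :
  measurable_fun setT (fun s : R => (kern a (t - s) * kern b (s - r))%:E).
Proof.
apply/measurable_EFinP; apply: measurable_funM; first exact: measurable_kern_sub.
by apply: measurableT_comp; [exact: measurable_kern|exact: measurable_funB].
Qed.

(** Integrating [|Phi|] in [s] first leaves [kern (a + b) (t - r) * |g r|]. As [a + b >= 1], this
    kernel is bounded on the support of [g], so the integrability of [f] suffices at the given point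
    [t]. *)
Let integrable_Phi : (leb \x leb)%E.-integrable setT Phi.
Proof.
apply/(@integrable21ltyP _ _ _ _ R leb leb Phi measurable_Phi).
have -> : (\int[leb]_r \int[leb]_s `|Phi (s, r)| =
    \int[leb]_r (kern (a + b)%R (t - r)%R * `|g r|)%R%:E)%E.
  apply: eq_integral => r _; rewrite EFinM -integral_kern_kern.
  rewrite -ge0_integralZr//; last 2 first.
    exact: measurable_kern_kern.
    by move=> s _; rewrite lee_fin mulr_ge0 ?kern_ge0.
  apply: eq_integral => s _; rewrite /Phi/= -EFinM mulrA normrM ger0_norm//.
  by rewrite mulr_ge0 ?kern_ge0.
have ab0 : 0 < a + b by rewrite addr_gt0.
pose C := t `^ (a + b - 1) / Gamma (a + b).
apply: (@le_lt_trans _ _ (\int[leb]_r (C%:E * `|(EFin \o g) r|))%E).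
  apply: ge0_le_integral => //.
  - by move=> r _; rewrite lee_fin mulr_ge0 ?kern_ge0.
  - apply/measurable_EFinP; apply: measurable_funM; first exact: measurable_kern_sub.
    exact: measurableT_comp.
  - apply: emeasurable_funM => //; apply: measurableT_comp => //; exact/measurable_EFinP.
  - move=> r _; rewrite /= -EFinM lee_fin /g restrictP.
    case: ifPn => [/andP[r0 _]|_]; last by rewrite normr0 !mulr0.
    by apply: ler_wpM2r => //; apply: kern_le => //; [rewrite gerBl ltW|exact: ltW].
have /integrableP[_ gfin] := ig.
rewrite ge0_integralZl_EFin//.
- rewrite -ge0_fin_numE; last by rewrite mule_ge0 ?integral_ge0// lee_fin divr_ge0 ?powR_ge0// ltW// Gamma_gt0.
  by rewrite fin_numM// ge0_fin_numE// integral_ge0.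
- by apply: measurableT_comp => //; exact/measurable_EFinP.
- by rewrite divr_ge0 ?powR_ge0// ltW// Gamma_gt0.
Qed.

Let F (s : R) := (\int[leb]_r Phi (s, r))%E.

(** For [f] merely integrable the inner integral may diverge at some [s], where [F] and the
    real-valued [frac] need not agree. Fubini confines these [s] to a null set, which the outer
    integral ignores. *)
Let F_ae : ae_eq leb `]0, t[%classic F (EFin \o (fun s => kern a (t - s) * frac b f s)).
Proof.
apply: filterS (ae_integrable1 integrable_Phi) => s iPhi.
rewrite /= in_itv/= => /andP[s0 st].
have k0 : 0 < kern a (t - s) by rewrite kern_gt0// subr_gt0.
have iH : leb.-integrable setT (fun r => (kern b (s - r) * g r)%:E).
  have := integrableZl (measurableT) (kern a (t - s))^-1 iPhi.
  by under eq_fun do rewrite /Phi/= -EFinM mulKf ?gt_eqF//.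
rewrite /F /Phi/=; under eq_integral do rewrite EFinM.
rewrite integralZl// frac_H// EFinM /H fineK//; exact: integrable_fin_num.
Qed.

Let mkf : measurable_fun `]0, t[ (fun s => kern a (t - s) * frac b f s).
Proof.
apply: measurable_funM; last exact: measurable_frac.
apply: measurable_funTS; exact: measurable_kern_sub.
Qed.

Let iF : leb.-integrable setT F.
Proof. exact: (integrable_fubini_F integrable_Phi). Qed.

Lemma integrable_frac :
  leb.-integrable `]0, t[ (EFin \o (fun s => kern a (t - s) * frac b f s)).
Proof.
have iF' : leb.-integrable `]0, t[ F by apply: integrableS iF.
have /integrableP[mF Foo] := iF'.
apply/integrableP; split; first exact/measurable_EFinP.
rewrite (_ : (\int[leb]_(s in _) _)%E = (\int[leb]_(s in `]0%R, t[) `|F s|)%E)//.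
apply: ae_eq_integral => //.
- by apply: measurableT_comp => //; exact/measurable_EFinP.
- exact: measurableT_comp.
- exact/ae_eq_abse/ae_eq_sym/F_ae.
Qed.

Lemma frac_frac : frac a (frac b f) t = frac (a + b) f t.
Proof.
rewrite /frac /Rintegral; congr fine.
transitivity (\int[leb]_(s in `]0%R, t[) F s)%E.
  apply: ae_eq_integral => //.
  - exact/measurable_EFinP.
  - by have /integrableP[mF _] := iF; exact: measurable_funTS.
  - exact/ae_eq_sym/F_ae.
transitivity (\int[leb]_s F s)%E.
  rewrite integral_mkcond; apply: eq_integral => s _; rewrite patchE.
  case: ifPn => // /negP sI.
  rewrite /F /Phi/= integral0_eq// => r _.
  have [s0|s0] := ltP 0 s.
    rewrite kern_neg ?mul0r// subr_le0 leNgt; apply/negP => st.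
    by apply: sI; rewrite inE/= in_itv/= s0.
  rewrite /g restrictP; case: ifPn => [/andP[r0 _]|_]; last by rewrite !mulr0.
  by rewrite [kern b _]kern_neg ?mul0r ?mulr0// subr_le0 (le_trans s0)// ltW.
rewrite [LHS](Fubini integrable_Phi) [RHS]integral_mkcond; apply: eq_integral => r _.
transitivity (\int[leb]_s ((kern a (t - s) * kern b (s - r))%R%:E * (g r)%:E))%E.
  by apply: eq_integral => s _; rewrite /Phi/= -EFinM mulrA.
rewrite integralZr//; last first.
  apply/integrableP; split; first exact: measurable_kern_kern.
  rewrite [X in (X < _)%E](_ : _ = (kern (a + b) (t - r))%:E) ?ltry// -integral_kern_kern.
  by apply: eq_integral => s _; rewrite /= ger0_norm// mulr_ge0 ?kern_ge0.
rewrite integral_kern_kern -EFinM /g !patchE; case: ifP => // _.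
by rewrite mulr0.
Qed.

End frac_comp.

(** * Exponentially weighted bounds and the Volterra equation *)

Section frac_continuous.
Context {R : realType}.
Implicit Types (a b c s t : R) (f g w : R -> R).

Lemma integrable_kern a t : 0 < a ->
  leb.-integrable `]0, t[ (fun s : R => (kern a (t - s))%:E).
Proof.
move=> a0; apply: (@eq_integrable _ _ R leb _ (measurable_itv _) (fun s : R => (kern a (t - s) * kern 1 s)%:E)) => //.
  by move=> s /set_mem/= sI; rewrite kern1 ?mulr1// (itvP sI).
exact: integrable_kern_conv.
Qed.

Lemma integrable_kernM a t w : 0 < a -> measurable_fun `]0, t[ w ->
  (exists M, forall s, s \in `]0, t[ -> `|w s| <= M) ->
  leb.-integrable `]0, t[ (EFin \o (fun s : R => kern a (t - s) * w s)).
Proof.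
move=> a0 mw [M hM].
apply: (@eq_integrable _ _ R leb _ (measurable_itv _) ((fun s : R => (kern a (t - s)%R)%:E) \* (EFin \o w))%E) => //.
apply: integrableMl => //; first exact: integrable_kern.
exists M; split; first exact: num_real.
by move=> x Mx s sI /=; rewrite (le_trans (hM s _)) ?ltW.
Qed.

Lemma integrable_kernM_ge1 a t f : 1 <= a ->
  leb.-integrable `]0, t[ (EFin \o f) ->
  leb.-integrable `]0, t[ (EFin \o (fun s : R => kern a (t - s) * f s)).
Proof.
move=> a1 fi.
apply: (@eq_integrable _ _ R leb _ (measurable_itv _)
  ((EFin \o (fun s : R => kern a (t - s)%R)) \* (EFin \o f))%E) => //.
apply: integrableMr => //.
  by apply: measurable_funTS; exact: measurable_kern_sub.
exists (t `^ (a - 1) / Gamma a); split; first exact: num_real.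
move=> x Mx s /=; rewrite in_itv/= => /andP[s0 st].
have a0 : 0 < a by rewrite (lt_le_trans ltr01).
have t0 : 0 <= t by rewrite ltW// (lt_trans s0).
rewrite ger0_norm ?kern_ge0// (le_trans _ (ltW Mx))// kern_le// lerBlDr lerDl ltW//.
Qed.

Lemma integrable_of_kernM a t f : 0 < a -> a <= 1 ->
  leb.-integrable `]0, t[ (EFin \o (fun s : R => kern a (t - s) * f s)) ->
  leb.-integrable `]0, t[ (EFin \o f).
Proof.
move=> a0 a1 kfi.
(* The inverse of the kernel, bounded on []0, t[] because its exponent [1 - a] is nonnegative. *)
pose h (s : R) := Gamma a * (t - s) `^ (1 - a).
pose k (s : R) := kern a (t - s) * f s.
apply: (@eq_integrable _ _ R leb _ (measurable_itv _) ((EFin \o h) \* (EFin \o k))%E) => //.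
  move=> s /set_mem/=; rewrite in_itv/= => /andP[s0 st].
  have ts : 0 < t - s by rewrite subr_gt0.
  rewrite /= -EFinM /h /k; congr EFin; rewrite kern_pos// -[1 - a]opprB powRN.
  field; rewrite !gt_eqF ?powR_gt0 ?Gamma_gt0//.
apply: integrableMr => //.
  apply: measurable_funTS; apply: measurable_funM => //.
  have mts : measurable_fun setT (fun s : R => t - s) by exact: measurable_funB.
  exact: (measurableT_comp (@measurable_powR R (1 - a)) mts).
exists (Gamma a * t `^ (1 - a)); split; first exact: num_real.
move=> x Mx s /=; rewrite in_itv/= => /andP[s0 st].
rewrite ger0_norm ?mulr_ge0 ?powR_ge0 ?ltW ?Gamma_gt0//.
rewrite (le_lt_trans _ Mx)// ler_pM2l ?Gamma_gt0//.
by rewrite ge0_ler_powR// ?nnegrE ?subr_ge0// ?ltW// ?(lt_trans s0)// ltrBlDr ltrDl.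
Qed.

Lemma fracZ a t c f :
  leb.-integrable `]0, t[ (EFin \o (fun s : R => kern a (t - s) * f s)) ->
  frac a (fun s : R => c * f s) t = c * frac a f t.
Proof.
move=> fi; rewrite /frac -RintegralZl//.
by apply: eq_Rintegral => s _; rewrite mulrCA.
Qed.

Lemma fracD a t f g :
  leb.-integrable `]0, t[ (EFin \o (fun s : R => kern a (t - s) * f s)) ->
  leb.-integrable `]0, t[ (EFin \o (fun s : R => kern a (t - s) * g s)) ->
  frac a (fun s : R => f s + g s) t = frac a f t + frac a g t.
Proof.
move=> fi gi; rewrite /frac -RintegralD//.
by apply: eq_Rintegral => s _; rewrite mulrDr.
Qed.

Lemma continuous_bounded a b w : {within `[a, b], continuous w} ->
  exists M, forall s, s \in `[a, b] -> `|w s| <= M.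
Proof.
move=> cw.
have /= /compact_bounded [M [_ hM]] := continuous_compact cw (@segment_compact R a b).
exists (M + 1) => s sI; apply: (hM (M + 1)); first by rewrite ltrDl.
by exists s.
Qed.

Lemma within_continuousS a t w : {within `[a, +oo[, continuous w} ->
  {within `[a, t], continuous w}.
Proof.
apply: continuous_subspaceW; apply: subset_itvl; by rewrite bnd_simp.
Qed.

Lemma measurable_continuous a t w : {within `[a, +oo[, continuous w} ->
  measurable_fun `]a, t[ w.
Proof.
move=> /(within_continuousS (t := t)) cw.
apply: (@measurable_funS _ _ _ _ `[a, t]) => //; first exact: subset_itv_oo_cc.
exact: subspace_continuous_measurable_fun.
Qed.

Lemma integrable_kern_continuous a t w : 0 < a -> {within `[0, +oo[, continuous w} ->
  leb.-integrable `]0, t[ (EFin \o (fun s : R => kern a (t - s) * w s)).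
Proof.
move=> a0 cw; apply: integrable_kernM => //; first exact: measurable_continuous.
have [M hM] := continuous_bounded (within_continuousS (t := t) cw).
by exists M => s sI; apply: hM; exact: subset_itv_oo_cc.
Qed.

(** Writing [exp (c s) = exp (c t) exp (- c (t - s))] leaves the Laplace transform of the kernel at
    [c], cut off at [t]; its full value is [c ^ (- a)]. *)
Lemma frac_bound a c t M w : 0 < a -> 0 < c -> 0 <= M ->
  leb.-integrable `]0, t[ (EFin \o (fun s : R => kern a (t - s) * w s)) ->
  (forall s, s \in `]0, t[ -> `|w s| <= M * expR (c * s)) ->
  `|frac a w t| <= M * c `^ (- a) * expR (c * t).
Proof.
move=> a0 c0 M0 wi hw.
have mc u : measurable_fun setT (fun s : R => expR (- (c * (u - s)))).
  apply: measurableT_comp; first exact: measurable_expR.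
  apply: measurableT_comp; first exact: oppr_measurable.
  by apply: measurable_funM => //; exact: measurable_funB.
have mk : measurable_fun setT (fun s : R => (kern a (t - s) * expR (- (c * (t - s))))%:E).
  by apply/measurable_EFinP; apply: measurable_funM => //; exact: measurable_kern_sub.
rewrite -lee_fin EFin_normr_Rintegral//.
apply: (le_trans (le_abse_integral _ _ _)) => //; first exact: measurable_int wi.
have E s : M * (kern a (t - s) * expR (c * s)) =
    M * expR (c * t) * (kern a (t - s) * expR (- (c * (t - s)))).
  have -> : expR (c * s) = expR (c * t) * expR (- (c * (t - s))).
    by rewrite -expRD; congr expR; ring.
  by ring.
apply: (@le_trans _ _ (\int[leb]_(s in `]0%R, t[)
   ((M * expR (c * t))%R%:E * (kern a (t - s) * expR (- (c * (t - s))))%R%:E))%E).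
  apply: ge0_le_integral => //.
  - by apply: measurableT_comp => //; exact: measurable_int wi.
  - apply: measurable_funTS; by apply: emeasurable_funM.
  - move=> s sI; rewrite -EFinM -E /= lee_fin normrM ger0_norm ?kern_ge0//.
    by rewrite mulrCA ler_wpM2l ?kern_ge0// hw.
have k0 s : (0 <= (kern a (t - s) * expR (- (c * (t - s))))%:E)%E.
  by rewrite lee_fin mulr_ge0 ?kern_ge0 ?expR_ge0.
rewrite ge0_integralZl_EFin ?mulr_ge0 ?expR_ge0//; last exact: measurable_funTS.
rewrite [M * c `^ (- a) * _]mulrAC [leRHS]EFinM; apply: lee_wpmul2l; first by rewrite lee_fin mulr_ge0 ?expR_ge0.
rewrite -(kern_laplace a0 c0) (integral_reflect t)//; last 2 first.
- exact: measurable_kern_expR.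
- by move=> s; rewrite lee_fin mulr_ge0 ?kern_ge0 ?expR_ge0.
by apply: ge0_subset_integral.
Qed.

(* The weight [expR (c * s)] turns the Volterra operator into a contraction once
   [c `^ (- nu)] is small. *)
Lemma volterra_eq0 (lam nu : R) w : 0 < lam -> 0 < nu ->
  {within `[0, +oo[, continuous w} -> w 0 = 0 ->
  (forall t, 0 < t -> w t + 2 * lam * frac nu w t + lam ^+ 2 * frac (2 * nu) w t = 0) ->
  forall t, 0 < t -> w t = 0.
Proof.
move=> lam0 nu0 cw w0 hw T T0.
(* Chosen so that [2 lam c^(- nu) + lam^2 c^(- 2 nu) = 2 / 3 + 1 / 9], which is less than 1. *)
pose c := (3 * lam) `^ nu^-1.
have c0 : 0 < c by apply: powR_gt0; exact: mulr_gt0.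
have cnu : c `^ (- nu) = (3 * lam)^-1.
  by rewrite /c -powRrM mulrN mulVf ?gt_eqF// powR_inv1// mulr_ge0 ?ltW.
have c2nu : c `^ (- (2 * nu)) = (3 * lam)^-1 ^+ 2.
  have -> : - (2 * nu) = - nu * 2%:R by rewrite mulNr mulrC.
  by rewrite powRrM cnu powR_mulrn// invr_ge0 mulr_ge0// ltW.
have cwT := within_continuousS (t := T) cw.
have ce : {within `[0, T], continuous (fun s : R => `|w s| * expR (- (c * s)))}.
  move=> s; apply: cvgM; first by apply: cvg_norm; exact: cwT.
  have := @continuous_subspaceT R R `[0, T] (fun s : R => expR (- (c * s))); apply.
  move=> {}s; apply: continuous_comp; last exact: continuous_expR.
  by apply: continuousN; exact: mulrl_continuous.
(* The weighted norm is attained at some [m]. If [m > 0], the equation at this single point yields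
   [M <= (7 / 9) M]; if [m = 0], then [M = 0] because [w 0 = 0]. *)
have [m mI mmax] := EVT_max (ltW T0) ce.
set M := `|w m| * expR (- (c * m)) in mmax.
have M0 : 0 <= M by rewrite mulr_ge0 ?expR_ge0.
have wle s : s \in `[0, T] -> `|w s| <= M * expR (c * s).
  by move=> /mmax; rewrite expRN ler_pdivrMr ?expR_gt0.
suff : M <= 0.
  move=> Mle; have : `|w T| <= 0.
    rewrite (le_trans (wle T _))//; first by rewrite in_itv/= lexx ltW.
    by rewrite mulr_le0_ge0 ?expR_ge0.
  by rewrite normr_le0 => /eqP.
have [m0|m0] := ltP 0 m; last first.
  have mE : m = 0 by apply/eqP; rewrite eq_le m0 (itvP mI).
  by rewrite /M mE w0 normr0 mul0r.
have wl s : s \in `]0, m[ -> `|w s| <= M * expR (c * s).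
  move=> sI; apply: wle; move: sI mI; rewrite !in_itv/= => /andP[s0 sm] /andP[_ mT].
  by rewrite (ltW s0) (le_trans (ltW sm)).
have b1 := frac_bound nu0 c0 M0 (integrable_kern_continuous m nu0 cw) wl.
have nu20 : 0 < 2 * nu by rewrite mulr_gt0.
have b2 := frac_bound nu20 c0 M0 (integrable_kern_continuous m nu20 cw) wl.
have := hw m m0; move: b1 b2; move: (frac nu w m) (frac (2 * nu) w m) => A B b1 b2.
rewrite -addrA => /eqP; rewrite addr_eq0 => /eqP wm.
have X0 : 0 < expR (c * m) by exact: expR_gt0.
have wmE : `|w m| = M * expR (c * m) by rewrite /M -mulrA -expRD addNr expR0 mulr1.
have : `|w m| <= 2 * lam * `|A| + lam ^+ 2 * `|B|.
  rewrite wm normrN; apply: (le_trans (ler_normD _ _)).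
  by rewrite !normrM normr_nat (gtr0_norm lam0) expr2 lexx.
have e1 := ler_wpM2l (ltW (mulr_gt0 (ltr0n _ 2) lam0)) b1.
have e2 := ler_wpM2l (sqr_ge0 lam) b2.
rewrite cnu in e1; rewrite c2nu in e2.
have lam_neq0 : lam != 0 by rewrite gt_eqF.
have f1 : 2 * lam * (M * (3 * lam)^-1 * expR (c * m)) = 2 / 3 * (M * expR (c * m)) by field.
have f2 : lam ^+ 2 * (M * (3 * lam)^-1 ^+ 2 * expR (c * m)) = 1 / 9 * (M * expR (c * m)) by field.
rewrite f1 in e1; rewrite f2 in e2; rewrite wmE => h.
by rewrite -(pmulr_lle0 _ X0); lra.
Qed.

End frac_continuous.

(** * Reduction of the Cauchy problem to a Volterra equation *)

Section caputo.
Context {R : realType}.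
Implicit Types (mu t s a : R) (u : R -> R).

Lemma caputo_orderE mu (m : nat) : m%:R - 1 < mu -> mu <= m%:R -> caputo_order mu = m.
Proof.
move=> h1 h2; rewrite /caputo_order (_ : Num.ceil mu = m%:Z) ?absz_nat//.
by apply: ceil_def; rewrite -pmulrn intrB -pmulrn h2 andbT.
Qed.

Lemma caputo_integrandE mu (m : nat) u t s : m%:R - 1 < mu -> mu < m%:R -> s < t ->
  caputo_integrand mu u t s =
  Gamma (m%:R - mu) * (kern (m%:R - mu) (t - s) * derive1n m u s).
Proof.
move=> h1 h2 st; have G0 : 0 < Gamma (m%:R - mu) by rewrite Gamma_gt0// subr_gt0.
rewrite /caputo_integrand (caputo_orderE h1 (ltW h2)) kern_pos ?subr_gt0// -powRN mulrA.
congr (_ * _); rewrite mulrC divfK ?gt_eqF//; congr (_ `^ _); ring.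
Qed.

Lemma integrable_caputo_integrand mu (m : nat) u t : m%:R - 1 < mu -> mu < m%:R ->
  leb.-integrable `]0, t[ (EFin \o caputo_integrand mu u t) <->
  leb.-integrable `]0, t[ (EFin \o (fun s => kern (m%:R - mu) (t - s) * derive1n m u s)).
Proof.
move=> h1 h2; have G0 : 0 < Gamma (m%:R - mu) by rewrite Gamma_gt0// subr_gt0.
have E (s : R) : s \in (`]0, t[%classic : set R) -> caputo_integrand mu u t s =
  Gamma (m%:R - mu) * (kern (m%:R - mu) (t - s) * derive1n m u s).
  by move=> /set_mem/=; rewrite in_itv/= => /andP[_ st]; rewrite (@caputo_integrandE _ m).
split=> [h|h].
  apply: (@eq_integrable _ _ R leb _ (measurable_itv _)
    (fun s : R => (Gamma (m%:R - mu))^-1%:E * (EFin \o caputo_integrand mu u t) s)%E).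
    by move=> s sI; rewrite /= -EFinM E// mulKf ?gt_eqF.
  exact: integrableZl.
pose k (s : R) := kern (m%:R - mu) (t - s) * derive1n m u s.
apply: (@eq_integrable _ _ R leb _ (measurable_itv _)
    (fun s : R => (Gamma (m%:R - mu))%:E * (EFin \o k) s)%E).
  by move=> s sI; rewrite /= E.
exact: integrableZl.
Qed.

Lemma caputoE mu (m : nat) u t : m%:R - 1 < mu -> mu < m%:R ->
  leb.-integrable `]0, t[ (EFin \o (fun s => kern (m%:R - mu) (t - s) * derive1n m u s)) ->
  caputo mu u t = frac (m%:R - mu) (derive1n m u) t.
Proof.
move=> h1 h2 hi; have G0 : 0 < Gamma (m%:R - mu) by rewrite Gamma_gt0// subr_gt0.
rewrite /caputo (caputo_orderE h1 (ltW h2)) lt_eqF//.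
rewrite (_ : \int[leb]_(s in _) _ = Gamma (m%:R - mu) * frac (m%:R - mu) (derive1n m u) t).
  by rewrite mulKf// gt_eqF.
rewrite /frac -RintegralZl//; apply: eq_Rintegral => s /set_mem/=.
by rewrite in_itv/= => /andP[_ st]; rewrite (@caputo_integrandE _ m).
Qed.

#[global] Opaque frac.

Lemma caputo_nat (m : nat) u t : caputo m%:R u t = derive1n m u t.
Proof. by rewrite /caputo (@caputo_orderE _ m) ?eqxx// gtrBl. Qed.

(** For [mu < m] the Caputo derivative is [I^(m - mu)] of the ordinary one, and the semigroup law
    applies. For [mu = m] the kernel of order 0 would be a Dirac mass, so this case is treated
    apart. *)
Lemma frac_caputo a mu (m : nat) u t : 0 < a -> m%:R - 1 < mu -> mu <= m%:R ->
  1 <= a + (m%:R - mu) -> 0 < t ->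
  leb.-integrable `]0, t[ (EFin \o derive1n m u) ->
  (mu < m%:R -> forall s, 0 < s ->
    leb.-integrable `]0, s[ (EFin \o caputo_integrand mu u s)) ->
  leb.-integrable `]0, t[ (EFin \o (fun s => kern a (t - s) * caputo mu u s)) /\
  frac a (caputo mu u) t = frac (a + (m%:R - mu)) (derive1n m u) t.
Proof.
move=> a0 h1 h2 am t0 fi ci; have [mum|mum] := eqVneq mu m%:R.
  rewrite mum subrr addr0 in am *.
  have -> : caputo m%:R u = derive1n m u by apply/funext => s; exact: caputo_nat.
  by split => //; exact: integrable_kernM_ge1.
have {h2 mum} h2 : mu < m%:R by rewrite lt_neqAle mum.
have mmu0 : 0 < m%:R - mu by rewrite subr_gt0.
have E s : s \in `]0, t[ -> caputo mu u s = frac (m%:R - mu) (derive1n m u) s.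
  by move=> sI; apply: caputoE => //; apply/integrable_caputo_integrand => //; apply: ci; rewrite ?(itvP sI).
split; last by rewrite (eq_frac _ E) frac_frac.
have := integrable_frac t0 fi a0 mmu0 am.
by apply: eq_integrable => // s /set_mem/= sI; rewrite E.
Qed.

End caputo.

Section solution.
Context {R : realType}.
Implicit Types (t s a lam nu : R) (u q : R -> R).

Lemma derivable_continuous u s : derivable u s 1 -> {for s, continuous u}.
Proof. by move=> du; exact/differentiable_continuous/derivable1_diffP. Qed.

Lemma derivable_within_continuous u a t : 0 < a ->
  (forall s, 0 < s -> derivable u s 1) -> {within `[a, t], continuous u}.
Proof.
move=> a0 du; apply: continuous_in_subspaceT => s; rewrite inE/= in_itv/= => /andP[as_ _].
by apply: derivable_continuous; apply: du; exact: lt_le_trans as_.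
Qed.

Lemma measurable_derivable u t : (forall s, 0 < s -> derivable u s 1) ->
  measurable_fun `]0, t[ u.
Proof.
move=> du; apply: open_continuous_measurable_fun; first exact: interval_open.
move=> s; rewrite inE/= in_itv/= => /andP[s0 _].
by apply: derivable_continuous; exact: du.
Qed.

Lemma derive1n1_is_derive (n : nat) u s : derivable (derive1n n u) s 1 ->
  is_derive s (1 : R) (derive1n n u) (derive1n n.+1 u s).
Proof. by move=> du; apply: DeriveDef; [exact: du|rewrite derive1nS derive1E]. Qed.

Lemma frac1_derive u t : 0 < t -> {within `[0, +oo[, continuous u} ->
  (forall s, 0 < s -> derivable u s 1) ->
  leb.-integrable `]0, t[ (EFin \o derive1n 1 u) ->
  frac 1 (derive1n 1 u) t = u t - u 0.
Proof.
move=> t0 cu du iu; rewrite frac1; apply: ftc_derive => //.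
  exact: within_continuousS.
move=> s sI; apply: (@derive1n1_is_derive 0); apply: du; by rewrite (itvP sI).
Qed.

(* The first derivative differs from the primitive of the second by a constant, which is the
   one-sided derivative at 0. *)
Lemma frac1_derive2 u t : 0 < t -> {within `[0, +oo[, continuous u} ->
  (forall s, 0 < s -> derivable u s 1) ->
  (forall s, 0 < s -> derivable (derive1n 1 u) s 1) ->
  leb.-integrable `]0, t[ (EFin \o derive1n 2 u) ->
  (u h - u 0) / h @[h --> 0^'+] --> (0 : R) ->
  forall s, 0 < s -> s < t -> derive1n 1 u s = frac 1 (derive1n 2 u) s.
Proof.
move=> t0 cu du ddu iu u0.
set v := frac 1 (derive1n 2 u).
(* The fundamental theorem is applied on [[s, r]], away from 0, where the first derivative is known
   to be continuous. *)
have diffE s r : 0 < s -> s < r -> r <= t -> derive1n 1 u r - derive1n 1 u s = v r - v s.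
  move=> s0 sr rt; rewrite /v !frac1.
  have irt : leb.-integrable `]0, r[ (EFin \o derive1n 2 u).
    by apply: integrableS iu => //; apply: subset_itvl; rewrite bnd_simp.
  have isr : leb.-integrable `]s, r[ (EFin \o derive1n 2 u).
    by apply: integrableS irt => //; apply: subset_itvr; rewrite bnd_simp ltW.
  have cu' : {within `[s, r], continuous (derive1n 1 u)} by exact: derivable_within_continuous.
  have du' x : x \in `]s, r[ -> is_derive x (1 : R) (derive1n 1 u) (derive1n 2 u x).
    by move=> xI; apply: derive1n1_is_derive; apply: ddu; rewrite (lt_trans s0)// (itvP xI).
  rewrite -(ftc_derive sr cu' du' isr) -(@Rintegral_itvB R _ (BRight 0) (BLeft r) s)//.
  - congr (_ - _); rewrite -Rintegral_itv_bndo_bndc//.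
    by apply: integrableS irt => //; apply: subset_itvl; rewrite bnd_simp ltW.
  - by rewrite bnd_simp ltW.
have vcvg : v h @[h --> 0^'+] --> (0 : R).
  pose g := derive1n 2 u \_ `]0, t[.
  have ig : leb.-integrable `[0, t] (EFin \o g).
    apply: (@integrableS _ _ _ leb setT) => //.
    by rewrite /g -restrict_EFin; apply/integrable_restrict => //; rewrite setTI.
  apply/cvgrPdist_lt => e e0.
  have [d /= d0 hd] := parameterized_integral_near_left t0 e0 ig.
  near=> h.
  have h0 : 0 < h by near: h; exact: nbhs_right_gt.
  have ht : h < t by near: h; exact: nbhs_right_lt.
  have hdd : h < d by near: h; exact: nbhs_right_lt.
  rewrite sub0r normrN.
  have -> : v h = \int[leb]_(x in `[0, h]) g x.
    rewrite /v frac1 -Rintegral_itv_obnd_cbnd; last first.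
      by apply: integrableS ig => //; apply: subset_itv; rewrite bnd_simp// ltW.
    rewrite -Rintegral_itv_bndo_bndc; last first.
      by apply: integrableS ig => //; apply: subset_itv; rewrite bnd_simp// ltW.
    apply: eq_Rintegral => x /set_mem/=; rewrite in_itv/= => /andP[x0 xh].
    by rewrite /g restrictP x0 (lt_trans xh ht).
  by apply: hd; [rewrite /ball_/= sub0r normrN gtr0_norm|exact: ltW].
move=> s s0 st.
pose l := derive1n 1 u s - v s.
have lE r : 0 < r -> r < t -> derive1n 1 u r = l + v r.
  move=> r0 rt; rewrite /l.
  have [/(diffE _ _ r0)/(_ (ltW st))|/(diffE _ _ s0)/(_ (ltW rt))|->] := ltgtP r s; last by rewrite subrK.
  - by move: (derive1n 1 u s) (derive1n 1 u r) (v s) (v r) => x1 x2 x3 x4 ?; lra.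
  - by move: (derive1n 1 u s) (derive1n 1 u r) (v s) (v r) => x1 x2 x3 x4 ?; lra.
suff : l = 0 by rewrite /l => /eqP; rewrite subr_eq0 => /eqP.
apply: (@cvg_unique _ _ ((fun h => (u h - u 0) / h) @ 0^'+)) => //.
apply/cvgrPdist_le => e e0.
move/cvgrPdist_le : (vcvg) => /(_ e e0) [d /= d0 hd].
near=> h.
have h0 : 0 < h by near: h; exact: nbhs_right_gt.
have ht : h < t by near: h; exact: nbhs_right_lt.
have hdd : h < d by near: h; exact: nbhs_right_lt.
(* By the mean value theorem the difference quotient at 0 is [l + v c] with [0 < c < h]. It tends to
   0 by hypothesis and to [l] because [v] tends to 0, so [l = 0]. *)
have [c cI cE] : exists2 c, c \in `]0, h[ & u h - u 0 = derive1n 1 u c * (h - 0).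
  apply: (@MVT _ u (derive1n 1 u) 0 h) => //; last exact: within_continuousS.
  by move=> x xI; apply: (@derive1n1_is_derive 0); apply: du; rewrite (itvP xI).
have c0 : 0 < c by rewrite (itvP cI).
have ch : c < h by rewrite (itvP cI).
rewrite cE subr0 mulfK ?gt_eqF// lE// ?(lt_trans ch)// opprD addNKr.
have := hd c; rewrite /ball_/= sub0r normrN gtr0_norm// (lt_trans ch)// => /(_ isT c0).
by rewrite sub0r.
Unshelve. all: by end_near. Qed.

(** Serves [nu = 1], where both orders are integers and [caputo_derivable] asks for no integral. The
    function [u' + 2 lam u] has the derivative [q], bounded on []0, t[], hence is itself bounded
    there by the mean value theorem; then so are [u'] and [u'']. *)
Lemma integrable_derive2 lam u q t : 0 < lam -> 0 < t ->
  {within `[0, +oo[, continuous u} -> {within `[0, +oo[, continuous q} ->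
  (forall s, 0 < s -> derivable u s 1) ->
  (forall s, 0 < s -> derivable (derive1n 1 u) s 1) ->
  (forall s, 0 < s -> derive1n 2 u s + 2 * lam * derive1n 1 u s = q s) ->
  leb.-integrable `]0, t[ (EFin \o derive1n 1 u) /\
  leb.-integrable `]0, t[ (EFin \o derive1n 2 u).
Proof.
move=> lam0 t0 cu cq du ddu E.
have [Mu hu] := continuous_bounded (within_continuousS (t := t) cu).
have [Mq hq] := continuous_bounded (within_continuousS (t := t) cq).
pose v s := derive1n 1 u s + 2 * lam * u s.
have dv s : 0 < s -> is_derive s (1 : R) v (q s).
  move=> s0; rewrite -E//.
  have d1 : is_derive s (1 : R) (derive1n 1 u) (derive1n 2 u s).
    by apply: derive1n1_is_derive; exact: ddu.
  have d2 : is_derive s (1 : R) u (derive1n 1 u s).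
    by apply: (@derive1n1_is_derive 0); exact: du.
  by apply: is_deriveD.
have Mq0 : 0 <= Mq by rewrite (le_trans (normr_ge0 (q t)))// hq// in_itv/= lexx ltW.
have vb s : s \in `]0, t[ -> `|v s| <= `|v t| + Mq * t.
  rewrite in_itv/= => /andP[s0 st].
  have [c cI cE] : exists2 c, c \in `]s, t[ & v t - v s = q c * (t - s).
    apply: MVT => //.
      by move=> x xI; apply: dv; rewrite (lt_trans s0)// (itvP xI).
    by apply: (derivable_within_continuous s0) => x x0; have [] := dv x x0.
  have -> : v s = v t - q c * (t - s) by rewrite -cE; ring.
  rewrite (le_trans (ler_normB _ _))// lerD2l normrM ler_pM//.
    by apply: hq; move: cI; rewrite !in_itv/= => /andP[sc ct]; rewrite (ltW ct) (ltW (lt_trans s0 sc)).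
  by rewrite gtr0_norm ?subr_gt0// gerBl ltW.
pose M1 := `|v t| + Mq * t + 2 * lam * Mu.
have b1 s : s \in `]0, t[ -> `|derive1n 1 u s| <= M1.
  move=> sI; have -> : derive1n 1 u s = v s - 2 * lam * u s by rewrite /v addrK.
  rewrite (le_trans (ler_normB _ _))// lerD ?vb// normrM ger0_norm ?mulr_ge0 ?(ltW lam0)//.
  by rewrite ler_wpM2l ?mulr_ge0 ?(ltW lam0)// hu//; apply: subset_itv_oo_cc sI.
have b2 s : s \in `]0, t[ -> `|derive1n 2 u s| <= Mq + 2 * lam * M1.
  move=> sI; have -> : derive1n 2 u s = q s - 2 * lam * derive1n 1 u s.
    by rewrite -E ?addrK// (itvP sI).
  rewrite (le_trans (ler_normB _ _))// lerD//.
    by apply: hq; exact: subset_itv_oo_cc sI.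
  rewrite normrM ger0_norm ?mulr_ge0 ?(ltW lam0)//.
  by rewrite ler_wpM2l ?mulr_ge0 ?(ltW lam0)// b1.
have m1 : measurable_fun `]0, t[ (derive1n 1 u) by exact: measurable_derivable.
have mt : (leb `]0%R, t[%classic < +oo)%E.
  by have := @lebesgue_measure_itv R `]0, t[; rewrite /= lte_fin t0 => ->; rewrite ltry.
split; apply: measurable_bounded_integrable => //.
- exists M1; split; first exact: num_real.
  by move=> x Mx s sI /=; apply: (le_trans (b1 s sI)); exact: ltW.
- apply: (eq_measurable_fun (fun s => q s - 2 * lam * derive1n 1 u s)).
    by move=> s /set_mem/= sI; rewrite -E ?addrK// (itvP sI).
  apply: measurable_funB; first exact: measurable_continuous.
  exact: measurable_funM.
- exists (Mq + 2 * lam * M1); split; first exact: num_real.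
  by move=> x Mx s sI /=; apply: (le_trans (b2 s sI)); exact: ltW.
Qed.

End solution.

Lemma fracB (R : realType) (a t : R) (f g : R -> R) :
  leb.-integrable `]0, t[ (EFin \o (fun s => kern a (t - s) * f s)) ->
  leb.-integrable `]0, t[ (EFin \o (fun s => kern a (t - s) * g s)) ->
  frac a (fun s => f s - g s) t = frac a f t - frac a g t.
Proof.
move=> fi gi; rewrite -[- frac a g t]mulN1r -fracZ// -fracD//.
  by apply: eq_frac => s _; rewrite mulN1r.
have := @integrableZl _ _ R leb _ (measurable_itv `]0, t[) (-1) _ gi.
by apply: eq_integrable => // s _ /=; rewrite -EFinM mulrCA.
Qed.

(** The semigroup law leaves the integer order [m]. For [m = 1] this is the primitive of [u']; for
    [m = 2] it is [I^1 (I^1 u'')], and the vanishing slope at 0 turns the inner primitive into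
    [u']. *)
Lemma frac_caputo2 (R : realType) (nu : R) (m : nat) (u : R -> R) (t : R) :
  0 < nu -> nu <= 1 -> (0 < m <= 2)%N -> m%:R - 1 < 2 * nu -> 2 * nu <= m%:R -> 0 < t ->
  {within `[0, +oo[, continuous u} ->
  (forall (j : nat) (s : R), (j < m)%N -> 0 < s -> derivable (derive1n j u) s 1) ->
  (forall s, 0 < s -> leb.-integrable `]0, s[ (EFin \o derive1n 1 u)) ->
  (forall s, 0 < s -> leb.-integrable `]0, s[ (EFin \o derive1n m u)) ->
  (2 * nu < m%:R -> forall s, 0 < s ->
    leb.-integrable `]0, s[ (EFin \o caputo_integrand (2 * nu) u s)) ->
  (m == 2 -> (u h - u 0) / h @[h --> 0^'+] --> (0 : R)) ->
  leb.-integrable `]0, t[ (EFin \o (fun s => kern (2 * nu) (t - s) * caputo (2 * nu) u s)) /\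
  frac (2 * nu) (caputo (2 * nu) u) t = u t - u 0.
Proof.
move=> nu0 nu1 m02 hm1 hm2 t0 cu du i1 im ci u0.
have m1 : 1 <= m%:R :> R by rewrite ler1n; case/andP: m02.
have nu20 : 0 < 2 * nu by rewrite mulr_gt0.
have E : 2 * nu + (m%:R - 2 * nu) = m%:R by ring.
have [|h1 h2] := frac_caputo nu20 hm1 hm2 _ t0 (im t t0) ci; first by rewrite E.
split => //; rewrite h2 E => {h1 h2}.
move: m m02 {hm1 hm2 m1 E ci} du im u0 => [//|[_ du _ _|[_ du i2 u0|//]]].
  by apply: frac1_derive => //; [move=> s; exact: (du 0)|exact: i1].
have d1 s : 0 < s -> derivable u s 1 by exact: (du 0).
have d2 s : 0 < s -> derivable (derive1n 1 u) s 1 by exact: (du 1).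
rewrite -(frac1_derive t0 cu d1 (i1 _ t0)).
have le12 : (1 : R) <= 1 + 1 by rewrite lerDl.
rewrite [2%:R]mulr2n -(frac_frac t0 (i2 _ t0) ltr01 ltr01 le12).
apply: eq_frac => s; rewrite in_itv/= => /andP[s0 st].
exact/esym/(frac1_derive2 t0 cu d1 d2 (i2 _ t0) (u0 isT)).
Qed.

(** [m] is the Caputo order of [2 nu]. For [nu < 1] the order [nu] gives the integrability of [u'],
    also at [nu = 1 / 2], where [2 nu] is the integer 1. For [1 / 2 < nu < 1] the order [2 nu] gives
    that of [u''], and for [nu = 1] both come from the equation. *)
Lemma solution_integrable (R : realType) (lam nu : R) (p : nat -> R -> R) (k : nat) :
  0 < lam -> 0 < nu -> nu <= 1 -> cauchy_solution lam nu p ->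
  exists m : nat, [/\ (0 < m <= 2)%N, m%:R - 1 < 2 * nu, 2 * nu <= m%:R, (m == 2 -> 1 / 2 < nu) &
  forall t, 0 < t -> leb.-integrable `]0, t[ (EFin \o derive1n 1 (p k)) /\
    leb.-integrable `]0, t[ (EFin \o derive1n m (p k))].
Proof.
move=> lam0 nu0 nu1 sol.
have o1 : caputo_order nu = 1%N by apply: caputo_orderE; lra.
have [d1 i1] := sol_derivable sol k; rewrite o1 in d1 i1.
have [d2 i2] := sol_derivable2 sol k.
have I1 : nu < 1 -> forall t, 0 < t -> leb.-integrable `]0, t[ (EFin \o derive1n 1 (p k)).
  move=> nul1 t t0; apply: (@integrable_of_kernM _ (1 - nu)); [lra|lra|].
  apply/(@integrable_caputo_integrand _ nu 1); [lra|lra|].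
  by apply: i1 => //; rewrite lt_eqF.
have [nuh|nuh] := leP nu (1 / 2).
  exists 1%N; split => //; [lra|lra|].
  by move=> t t0; split; apply: I1 => //; lra.
exists 2%N; split => //; [lra|lra|].
have o2 : caputo_order (2 * nu) = 2%N by apply: caputo_orderE; lra.
rewrite o2 in d2 i2.
have [nu_eq1|nul1] := eqVneq nu 1; last first.
  have {}nul1 : nu < 1 by rewrite lt_neqAle nul1.
  move=> t t0; split; first exact: I1.
  apply: (@integrable_of_kernM _ (2 - 2 * nu)); [lra|lra|].
  apply/(@integrable_caputo_integrand _ (2 * nu) 2); [lra|lra|].
  by apply: i2 => //; rewrite lt_eqF//; lra.
pose q s := - lam ^+ 2 * (p k s - Defs.prev p k s).
have cq : {within `[0, +oo[, continuous q}.
  move=> s; apply: cvgM; first exact: cvg_cst.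
  apply: cvgB; first exact: (sol_continuous sol).
  by case: (k) => [|j] /=; [exact: cvg_cst|exact: (sol_continuous sol)].
move=> t t0; apply: (@integrable_derive2 R lam (p k) q t lam0 t0 (@sol_continuous _ _ _ _ sol k) cq).
- by move=> s s0; exact: (d2 0).
- by move=> s s0; exact: (d2 1%N).
- move=> s s0; rewrite /q -(sol_equation sol k s0) nu_eq1 mulr1.
  by rewrite (caputo_nat 2) (caputo_nat 1).
Qed.

Lemma solution_volterra (R : realType) (lam nu : R) (p : nat -> R -> R) (k : nat) (t : R) :
  0 < lam -> 0 < nu -> nu <= 1 -> cauchy_solution lam nu p -> 0 < t ->
  p k t - p k 0 + 2 * lam * frac nu (fun s => p k s - p k 0) t
  = - lam ^+ 2 * frac (2 * nu) (fun s => p k s - Defs.prev p k s) t.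
Proof.
move=> lam0 nu0 nu1 sol t0.
have [m [m02 hm1 hm2 m2 im]] := solution_integrable k lam0 nu0 nu1 sol.
have o1 : caputo_order nu = 1%N by apply: caputo_orderE; lra.
have o2 : caputo_order (2 * nu) = m by exact: caputo_orderE.
have [d1 i1] := sol_derivable sol k; rewrite o1 in d1 i1.
have [d2 i2] := sol_derivable2 sol k; rewrite o2 in d2 i2.
have cu := @sol_continuous _ _ _ _ sol k.
have nu20 : 0 < 2 * nu by rewrite mulr_gt0.
have im1 s : 0 < s -> leb.-integrable `]0, s[ (EFin \o derive1n 1 (p k)) by move=> /im[].
have imm s : 0 < s -> leb.-integrable `]0, s[ (EFin \o derive1n m (p k)) by move=> /im[].
have [iA fA] : leb.-integrable `]0, t[
    (EFin \o (fun s => kern (2 * nu) (t - s) * caputo (2 * nu) (p k) s)) /\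
    frac (2 * nu) (caputo (2 * nu) (p k)) t = p k t - p k 0.
  apply: (@frac_caputo2 _ _ m) => //.
  - by move=> h s s0; apply: i2 => //; rewrite lt_eqF.
  - by move=> /m2 h; exact: sol_init' sol h k.
have h1 : 1%:R - 1 < nu by rewrite subrr.
have h3 : 1 <= 2 * nu + (1%:R - nu) by lra.
have h4 : nu < 1%:R -> forall s, 0 < s ->
    leb.-integrable `]0, s[ (EFin \o caputo_integrand nu (p k) s).
  by move=> h s s0; apply: i1 => //; rewrite lt_eqF.
have [iB fB] := frac_caputo nu20 h1 nu1 h3 t0 (im1 t t0) h4.
(* The order [2 nu + (1 - nu)] acting on [u'] is regrouped as [nu + 1]. It is at least 1, as the
   pointwise semigroup law requires; the pair of orders [nu] and [nu] would fail this for
   [nu < 1 / 2]. *)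
have {fB} fB : frac (2 * nu) (caputo nu (p k)) t = frac nu (fun s => p k s - p k 0) t.
  rewrite fB (_ : 2 * nu + (1%:R - nu) = nu + 1); last by ring.
  rewrite -(frac_frac t0 (im1 t t0) nu0 ltr01); last by rewrite lerDr ltW.
  apply: eq_frac => s; rewrite in_itv/= => /andP[s0 st].
  by rewrite frac1_derive//; [move=> x; exact: (d1 0)|exact: im1].
rewrite -fA -fB -fracZ// -fracD//; last first.
  have := @integrableZl _ _ R leb _ (measurable_itv `]0, t[) (2 * lam) _ iB.
  by apply: eq_integrable => // s _ /=; rewrite -EFinM mulrCA.
rewrite -fracZ; last first.
  apply: integrable_kern_continuous => // s; apply: cvgB; first exact: cu.
  by case: (k) => [|j] /=; [exact: cvg_cst|exact: (sol_continuous sol)].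
apply: eq_frac => s; rewrite in_itv/= => /andP[s0 _].
exact: sol_equation.
Qed.

Lemma solution_unique (R : realType) (lam nu : R) (p q : nat -> R -> R) (k : nat) (t : R) :
  0 < lam -> 0 < nu -> nu <= 1 -> cauchy_solution lam nu p -> cauchy_solution lam nu q ->
  0 < t -> p k t = q k t.
Proof.
move=> lam0 nu0 nu1 solp solq.
have cp j := @sol_continuous _ _ _ _ solp j.
have cq j := @sol_continuous _ _ _ _ solq j.
have nu20 : 0 < 2 * nu by rewrite mulr_gt0.
(* Subtracting the two Volterra equations leaves the homogeneous one: the initial values and the
   previous components cancel. Agreement of the latter at positive times is enough under the
   integral. *)
have step j : (forall s, 0 < s -> Defs.prev p j s = Defs.prev q j s) ->
    forall s, 0 < s -> p j s = q j s.
  move=> hprev; pose w s := p j s - q j s.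
  have cw : {within `[0, +oo[, continuous w} by move=> s; apply: cvgB; [exact: cp|exact: cq].
  have p0q0 : p j 0 = q j 0 by rewrite (sol_init solp) (sol_init solq).
  have w0 : w 0 = 0 by rewrite /w p0q0 subrr.
  suff hw : forall s, 0 < s -> w s = 0.
    by move=> s s0; apply/eqP; rewrite -subr_eq0; apply/eqP; exact: hw.
  have cprev (r : nat -> R -> R) : (forall i, {within `[0, +oo[, continuous (r i)}) ->
      {within `[0, +oo[, continuous (Defs.prev r j)}.
    by move=> cr; case: (j) => [|i] s /=; [exact: cvg_cst|exact: cr].
  apply: (volterra_eq0 lam0 nu0 cw w0) => s s0.
  have Ep := solution_volterra j lam0 nu0 nu1 solp s0.
  have Eq := solution_volterra j lam0 nu0 nu1 solq s0.
  have F1 : frac nu w s = frac nu (fun r => p j r - p j 0) s - frac nu (fun r => q j r - q j 0) s.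
    rewrite -fracB; last 2 first.
    - by apply: integrable_kern_continuous => // r; apply: cvgB; [exact: cp|exact: cvg_cst].
    - by apply: integrable_kern_continuous => // r; apply: cvgB; [exact: cq|exact: cvg_cst].
    by apply: eq_frac => r _; rewrite /w p0q0; ring.
  have F2 : frac (2 * nu) w s = frac (2 * nu) (fun r => p j r - Defs.prev p j r) s -
      frac (2 * nu) (fun r => q j r - Defs.prev q j r) s.
    rewrite -fracB; last 2 first.
    - by apply: integrable_kern_continuous => // r; apply: cvgB; [exact: cp|exact: cprev].
    - by apply: integrable_kern_continuous => // r; apply: cvgB; [exact: cq|exact: cprev].
    by apply: eq_frac => r; rewrite in_itv/= => /andP[r0 _]; rewrite /w hprev//; ring.
  rewrite {}F1 {}F2 /w.
  move: (frac nu (fun r => p j r - p j 0) s) (frac nu (fun r => q j r - q j 0) s)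
    (frac (2 * nu) (fun r => p j r - Defs.prev p j r) s)
    (frac (2 * nu) (fun r => q j r - Defs.prev q j r) s) Ep Eq => A B C D Ep Eq.
  have := congr2 (fun x y => x - y) Ep Eq => H.
  apply/eqP; rewrite -subr_eq0 subr0; apply/eqP.
  rewrite -[RHS](subrr (- lam ^+ 2 * C - - lam ^+ 2 * D)) -{1}H p0q0; ring.
by elim: k t => [|k IH]; apply: step => // s s0; exact: IH.
Qed.

(** * Fractional power series *)

Section entire.
Context {R : realType}.
Implicit Types (b c : nat -> R) (x s nu be : R).

Definition geom_bounded b := exists C B : R, forall n, `|b n| <= C * B ^+ n.

(** Infinite radius of convergence, expressed by the coefficients alone so that it passes easily to
    the differentiated series. *)
Definition entire c := forall q : R, 0 < q -> exists K : R, forall n, `|c n| <= K * q ^+ n.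

Lemma entire_gamma nu be b : 0 < nu -> 0 < be -> geom_bounded b ->
  entire (fun n => b n / Gamma (nu * n%:R + be)).
Proof.
move=> nu0 be0 [C [B0 hb]] q q0.
pose B := `|B0| + 1.
have B_gt0 : 0 < B by rewrite ltr_wpDl.
have C0 : 0 <= C by have := hb 0; rewrite expr0 mulr1; apply: le_trans.
(* [Gamma_ge] is used at [c = M], so that [M ^ (- nu n) = (q / (2 B)) ^ n]. Here [B ^ n] absorbs the
   growth of [b], and [2 ^ n] the linear factor [x] that comes from
   [Gamma (x + 1) = x * Gamma x]. *)
pose M := (2 * B / q) `^ nu^-1.
have M0 : 0 < M by apply: powR_gt0; rewrite divr_gt0// mulr_gt0.
have Mnu : M `^ nu = 2 * B / q.
  by rewrite /M -powRrM mulVf ?gt_eqF// powRr1// ltW// divr_gt0// mulr_gt0.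
exists (C * (nu + be) * expR (M + 1) * M `^ (- be)) => n.
set x := nu * n%:R + be.
have x0 : 0 < x by rewrite ltr_wpDl// mulr_ge0// ltW.
have xle : x <= (nu + be) * 2 ^+ n.
  have n1 : 1 <= 2 ^+ n :> R by rewrite exprn_ege1// ler1n.
  have n2 : n%:R <= 2 ^+ n :> R by rewrite -natrX ler_nat ltnW// ltn_expl.
  rewrite mulrDl lerD//; first by rewrite ler_pM2l.
  by rewrite ler_peMr// ltW.
have Gx0 := Gamma_gt0 x0.
have GxE : (Gamma x)^-1 <= x * expR (M + 1) * M `^ (- x).
  have := Gamma_ge (ltW x0) M0; rewrite GammaD1// => h.
  have P0 : 0 < M `^ x by exact: powR_gt0.
  have E0 : 0 < expR (M + 1) by exact: expR_gt0.
  rewrite powRN -[leLHS]mul1r ler_pdivrMr//; rewrite expRN in h.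
  have -> : x * expR (M + 1) / M `^ x * Gamma x = x * Gamma x / (M `^ x / expR (M + 1)).
    by field; rewrite !gt_eqF.
  by rewrite ler_pdivlMr ?mul1r// divr_gt0.
have Mx : M `^ (- x) = M `^ (- be) * (q / (2 * B)) ^+ n.
  rewrite /x opprD powRD; last by apply/implyP => _; rewrite gt_eqF.
  rewrite mulrC; congr (_ * _); rewrite -mulNr powRrM powR_mulrn ?powR_ge0// powRN Mnu.
  by rewrite invf_div.
rewrite normrM (gtr0_norm (x := (Gamma x)^-1)) ?invr_gt0//.
have hbn : `|b n| <= C * B ^+ n.
  apply: (le_trans (hb n)); apply: ler_wpM2l => //.
  rewrite (le_trans (ler_norm _))// normrX lerXn2r// ?nnegrE//; first exact: ltW.
  by rewrite lerDl.
apply: (le_trans (ler_pM (normr_ge0 _) (ltW _) hbn GxE)); first by rewrite invr_gt0.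
rewrite Mx.
apply: (@le_trans _ _ (C * B ^+ n * ((nu + be) * 2 ^+ n * expR (M + 1) * (M `^ (- be) * (q / (2 * B)) ^+ n)))).
  apply: ler_wpM2l; first by rewrite mulr_ge0// exprn_ge0// ltW.
  apply: ler_wpM2r; last by apply: ler_wpM2r; [exact: expR_ge0|exact: xle].
  by rewrite mulr_ge0 ?powR_ge0// exprn_ge0// ltW// divr_gt0// mulr_gt0.
rewrite expr_div_n exprMn le_eqVlt; apply/orP; left; apply/eqP.
by field; rewrite ?expf_neq0// ?gt_eqF// ?pnatr_eq0.
Qed.

Lemma entire_cvg c x : entire c -> cvgn (series (fun n => `|c n * x ^+ n|)).
Proof.
(* With this rate the terms are at most [K / 2 ^ n]. *)
move=> ec; pose q := (2 * (`|x| + 1))^-1.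
have x1 : 0 < `|x| + 1 by rewrite ltr_wpDl.
have q0 : 0 < q by rewrite invr_gt0 mulr_gt0.
have [K hK] := ec q q0.
have K0 : 0 <= K by have := hK 0; rewrite expr0 mulr1; apply: le_trans.
apply: (@series_le_cvg _ _ (geometric K (2^-1))) => //.
- by move=> n; rewrite /geometric/= mulr_ge0// exprn_ge0.
- move=> n; rewrite normrM normrX /geometric/=.
  apply: (@le_trans _ _ (K * q ^+ n * (`|x| + 1) ^+ n)).
    by apply: ler_pM => //; apply: lerXn2r; rewrite ?nnegrE ?lerDl ?addr_ge0.
  rewrite -mulrA -exprMn /q invfM divfK ?gt_eqF//.
- by apply: is_cvg_geometric_series; rewrite gtr0_norm ?invr_gt0// invf_lt1// ltr1n.
Qed.

Lemma entire_diffs c : entire c -> entire (pseries_diffs c).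
Proof.
(* The factor [n + 1] of the differentiated series is paid for by halving the rate. *)
move=> ec q q0; have [|K hK] := ec (q / 2); first by rewrite divr_gt0.
have K0 : 0 <= K by have := hK 0; rewrite expr0 mulr1; apply: le_trans.
exists (K * q) => n; rewrite /pseries_diffs normrM ger0_norm//.
apply: (@le_trans _ _ (2 ^+ n.+1 * (K * (q / 2) ^+ n.+1))).
  by rewrite ler_pM// -natrX ler_nat ltnW// ltn_expl.
by rewrite mulrCA -exprMn mulrCA divff// mulr1 exprS mulrA.
Qed.

Lemma entire_continuous c : entire c -> continuous (fun x => limn (pseries c x)).
Proof.
move=> ec x; apply: derivable_continuous.
have cvgP d : entire d -> cvgn (pseries d (`|x| + 1)).
  by move=> ed; apply: normed_cvg; exact: entire_cvg.
have xlt : `|x| < `| (`|x| + 1) | by rewrite [ltRHS]ger0_norm ?addr_ge0// ltrDl.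
have [] // := @pseries_snd_diffs R c (`|x| + 1) x (cvgP _ ec) (cvgP _ (entire_diffs ec))
  (cvgP _ (entire_diffs (entire_diffs ec))) xlt.
Qed.

End entire.

(** The series in [X] of the overview when [be = 1]. A fractional integral of order [a] only
    replaces [be] by [be + a], and a derivative replaces it by [be - 1]. *)
Definition kseries (R : realType) (b : nat -> R) (nu be s : R) : R :=
  limn (series (fun n => b n * kern (nu * n%:R + be) s)).

Section kseries.
Context {R : realType}.
Variables (nu : R) (nu0 : 0 < nu).
Implicit Types (b c : nat -> R) (be s t a : R).

Lemma order_gt0 be n : 0 < be -> 0 < nu * n%:R + be.
Proof. by move=> be0; rewrite ltr_wpDl// mulr_ge0// ltW. Qed.

(** Splitting off the common power of [s] leaves an ordinary power series in [s ^ nu], from which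
    convergence and continuity are read off. *)
Lemma kern_term b be s n : 0 < s ->
  b n * kern (nu * n%:R + be) s =
  s `^ (be - 1) * (b n / Gamma (nu * n%:R + be) * (s `^ nu) ^+ n).
Proof.
move=> s0; rewrite kern_pos// (_ : nu * n%:R + be - 1 = be - 1 + nu * n%:R); last by ring.
rewrite powRD; last by apply/implyP => _; rewrite gt_eqF.
rewrite powRrM powR_mulrn ?powR_ge0//; ring.
Qed.

Lemma kseries_summable b be s : 0 < be -> geom_bounded b ->
  cvgn (series (fun n => `|b n * kern (nu * n%:R + be) s|)).
Proof.
move=> be0 hb; have [s0|s0] := ltP 0 s; last first.
  under eq_fun do rewrite kern_neg// mulr0 normr0.
  rewrite (_ : series _ = cst 0); first exact: is_cvg_cst.
  by apply/funext => n; rewrite /series/= big1.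
have ec := @entire_cvg R _ (s `^ nu) (entire_gamma nu0 be0 hb).
rewrite (_ : (fun n => _) = s `^ (be - 1) *: (fun n =>
    `|b n / Gamma (nu * n%:R + be) * (s `^ nu) ^+ n|)); first exact: is_cvg_seriesZ.
by apply/funext => n /=; rewrite kern_term// normrM (ger0_norm (powR_ge0 _ _)).
Qed.

Lemma kseries_cvg b be s : 0 < be -> geom_bounded b ->
  cvgn (series (fun n => b n * kern (nu * n%:R + be) s)).
Proof. by move=> be0 hb; apply: normed_cvg; exact: kseries_summable. Qed.

Lemma kseriesE b be s : 0 < be -> geom_bounded b -> 0 < s ->
  kseries b nu be s =
  s `^ (be - 1) * limn (pseries (fun n => b n / Gamma (nu * n%:R + be)) (s `^ nu)).
Proof.
move=> be0 hb s0; rewrite /kseries.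
have ec := @entire_cvg R _ (s `^ nu) (entire_gamma nu0 be0 hb).
have := @lim_seriesZ _ _ (s `^ (be - 1)) (normed_cvg ec).
rewrite /GRing.scale/= => <-; congr (limn (series _)).
by apply/funext => n /=; rewrite kern_term.
Qed.

Lemma kseries0 b be : kseries b nu be 0 = 0.
Proof.
rewrite /kseries; under eq_fun do rewrite kern_neg// mulr0.
rewrite (_ : series _ = cst 0); first exact: lim_cst.
by apply/funext => n; rewrite /series/= big1.
Qed.

Lemma continuous_kseries b be s : 0 < be -> geom_bounded b -> 0 < s ->
  {for s, continuous (kseries b nu be)}.
Proof.
move=> be0 hb s0.
pose P x := limn (pseries (fun n => b n / Gamma (nu * n%:R + be)) x).
have cP : continuous P by apply: entire_continuous; exact: entire_gamma.
have cF : {for s, continuous (fun x => x `^ (be - 1) * P (x `^ nu))}.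
  apply: cvgM; first exact: continuous_powR_pos.
  apply: (@continuous_comp _ _ _ (@powR R ^~ nu) P); first exact: continuous_powR_pos.
  exact: cP.
rewrite /prop_for /continuous_at kseriesE//.
apply: cvg_trans cF; apply: near_eq_cvg; near=> x.
by rewrite kseriesE//; near: x; exact: lt_nbhsr.
Unshelve. all: by end_near. Qed.

(** For [s <= 1] the argument [s ^ nu] of the continuous power series stays in the compact interval
    [[0, 1]]. This controls the solution at 0. *)
Lemma kseries_small b be : 0 < be -> geom_bounded b ->
  exists C, forall s, 0 < s -> s <= 1 -> `|kseries b nu be s| <= C * s `^ (be - 1).
Proof.
move=> be0 hb; pose P x := limn (pseries (fun n => b n / Gamma (nu * n%:R + be)) x).
have cP : continuous P by apply: entire_continuous; exact: entire_gamma.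
have [C hC] := @continuous_bounded R 0 1 P (continuous_subspaceT cP).
exists C => s s0 s1; rewrite kseriesE// normrM ger0_norm ?powR_ge0// mulrC.
rewrite ler_wpM2r ?powR_ge0// hC// in_itv/= powR_ge0 -(powRr0 s).
by rewrite ger_powR ?s0 ?s1// ltW.
Qed.

Lemma kseries_addn b be s m : 0 < be -> geom_bounded b ->
  kseries b nu be s = \sum_(0 <= i < m) b i * kern (nu * i%:R + be) s +
    kseries (fun n => b (n + m)%N) nu (be + nu * m%:R) s.
Proof.
move=> be0 hb; set f := fun n => b n * kern (nu * n%:R + be) s.
have cf : cvgn (series f) by exact: kseries_cvg.
pose g n := b (n + m)%N * kern (nu * n%:R + (be + nu * m%:R)) s.
suff H : series g n @[n --> \oo] --> limn (series f) - \sum_(0 <= i < m) f i.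
  have E : limn (series g) = limn (series f) - \sum_(0 <= i < m) f i by exact: cvg_lim H.
  by rewrite -[LHS](subrK (\sum_(0 <= i < m) f i)) -E addrC.
have -> : series g = (fun n => series f (n + m)%N - \sum_(0 <= i < m) f i).
  apply/funext => n; rewrite /series/= (big_cat_nat (leq0n m) (leq_addl n m))/= addrC addrK.
  rewrite -[in RHS](add0n m) [RHS]big_addn add0n addnK; apply: eq_bigr => i _.
  by rewrite /f natrD mulrDr -addrA [nu * m%:R + _]addrC.
apply: cvgB; last exact: cvg_cst.
by rewrite (cvg_shiftn m (series f)); exact: cf.
Qed.

(** Termwise integration by dominated convergence. The majorant is the sum of the [|phi n|], whose
    integral the convolution law turns into the absolutely convergent kernel series with parameter
    [be + a] at [t]. *)
Lemma frac_kseries b be a t : 0 < be -> 0 < a -> geom_bounded b -> 0 < t ->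
  leb.-integrable `]0, t[ (EFin \o (fun s => kern a (t - s) * kseries b nu be s)) /\
  frac a (kseries b nu be) t = kseries b nu (be + a) t.
Proof.
move=> be0 a0 hb t0.
have bea0 : 0 < be + a by rewrite addr_gt0.
pose phi n s := kern a (t - s) * (b n * kern (nu * n%:R + be) s).
have mphi n : measurable_fun setT (phi n).
  apply: measurable_funM; first exact: measurable_kern_sub.
  by apply: measurable_funM => //; exact: measurable_kern.
pose fn n s := (\sum_(0 <= i < n) phi i s)%:E.
have mfn n : measurable_fun `]0, t[ (fn n).
  apply: measurable_funTS; apply/measurable_EFinP.
  by apply: measurable_sum => i; exact: mphi.
have fncvg s : fn n s @[n --> \oo] --> (kern a (t - s) * kseries b nu be s)%:E.
  apply: cvg_EFin; first exact: nearW.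
  rewrite (_ : fine \o _ = (fun n => kern a (t - s) *
      series (fun n => b n * kern (nu * n%:R + be) s) n)).
    by apply: cvgM; [exact: cvg_cst|exact: kseries_cvg].
  by apply/funext => n; rewrite /fn/= mulr_sumr.
have mf : measurable_fun `]0, t[ (EFin \o (fun s => kern a (t - s) * kseries b nu be s)).
  by apply: (emeasurable_fun_cvg fn) => // x _; exact: fncvg.
pose g s := (\sum_(0 <= n <oo) `|phi n s|%:E)%E.
have intphi n : (\int[leb]_(s in `]0%R, t[) `|phi n s|%:E =
    `|b n * kern (nu * n%:R + (be + a)) t|%:E)%E.
  have o0 := order_gt0 n be0.
  rewrite (_ : nu * n%:R + (be + a) = a + (nu * n%:R + be)); last by ring.
  have ao0 := addr_gt0 a0 o0.
  rewrite normrM (ger0_norm (kern_ge0 t ao0)) EFinM -kern_conv_itv//.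
  rewrite -ge0_integralZl_EFin//.
  - apply: eq_integral => s _; rewrite -EFinM; congr EFin.
    by rewrite /phi normrM (normrM (b n)) (ger0_norm (kern_ge0 (t - s) a0)) (ger0_norm (kern_ge0 s o0)) mulrCA.
  - by move=> s _; rewrite lee_fin mulr_ge0 ?kern_ge0.
  - by have /integrableP[] := integrable_kern_conv t a0 o0.
have ig : leb.-integrable `]0, t[ g.
  have mabs n : measurable_fun `]0, t[ (fun s => `|phi n s|%:E).
    by apply: measurable_funTS; apply/measurable_EFinP; exact: measurableT_comp.
  apply/integrableP; split; first by apply: ge0_emeasurable_sum => // n _; exact: mabs.
  have -> : (\int[leb]_(s in `]0%R, t[) `|g s| =
      \sum_(0 <= n <oo) `|b n * kern (nu * n%:R + (be + a))%R t|%R%:E)%E.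
    transitivity (\int[leb]_(s in `]0%R, t[) g s)%E.
      apply: eq_integral => s _; rewrite gee0_abs//.
      by apply: nneseries_ge0 => i _ _; rewrite lee_fin.
    rewrite /g (@integral_nneseries _ _ R leb _ (measurable_itv `]0, t[)
      (fun n s => `|phi n s|%:E) mabs) => [|n s _]; last by rewrite lee_fin.
    by apply: eq_eseriesr => n _; exact: intphi.
  have := EFin_lim (@kseries_summable b (be + a) t bea0 hb) => E.
  rewrite (_ : limn _ = limn (EFin \o series (fun n => `|b n * kern (nu * n%:R + (be + a)) t|))).
    by rewrite E ltry.
  by congr (limn _); apply/funext => n; rewrite /= /series/= sumEFin.
have := @dominated_convergence _ _ R leb `]0, t[ (measurable_itv _) fn
  (EFin \o (fun s => kern a (t - s) * kseries b nu be s)) g.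
case.
- exact: mfn.
- exact: mf.
- by apply: aeW => s _; exact: fncvg.
- exact: ig.
- apply: aeW => s n _; rewrite /fn /= (le_trans _ (nneseries_lim_ge n _))//.
  by rewrite sumEFin lee_fin ler_norm_sum.
move=> h1 _ h2; split => //; rewrite fracE.
have intfn n : (\int[leb]_(s in `]0%R, t[) fn n s)%E =
    (series (fun n => b n * kern (nu * n%:R + (be + a)) t) n)%:E.
  have phiE i : EFin \o phi i =
      (fun s => (b i)%:E * (kern a (t - s) * kern (nu * i%:R + be) s)%R%:E)%E.
    by apply/funext => s; rewrite /= -EFinM mulrCA.
  have ikk i := integrable_kern_conv t a0 (order_gt0 i be0).
  have iphi i : leb.-integrable `]0, t[ (EFin \o phi i).
    by rewrite phiE; apply: integrableZl => //; exact: ikk.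
  have intphi' i : (\int[leb]_(s in `]0%R, t[) (phi i s)%:E =
      (b i * kern (nu * i%:R + (be + a)) t)%R%:E)%E.
    rewrite (_ : (fun s => (phi i s)%:E) = EFin \o phi i)// phiE.
    rewrite (@integralZl _ _ R leb _ (measurable_itv `]0, t[) _ (ikk i)).
    rewrite (kern_conv_itv t a0 (order_gt0 i be0)) EFinM.
    by rewrite (_ : a + (nu * i%:R + be) = nu * i%:R + (be + a)); last by ring.
  elim: n => [|n IH].
    rewrite /series/= big_geq// integral0_eq// => s _.
    by rewrite /fn big_geq.
  rewrite /series/= big_nat_recr//= EFinD -IH -intphi' -integralD//.
  - by apply: eq_integral => s _; rewrite /fn big_nat_recr.
  - rewrite (_ : fn n = (fun s => \sum_(0 <= i < n) (phi i s)%:E)%E).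
      by apply: integrable_sum => // i _; exact: iphi.
    by apply/funext => s; rewrite /fn sumEFin.
  - exact: iphi.
have c1 : series (fun n => b n * kern (nu * n%:R + (be + a)) t) n @[n --> \oo] -->
    kseries b nu (be + a) t by exact: kseries_cvg.
have c2 : (\int[leb]_(s in `]0%R, t[) fn n s)%E @[n --> \oo] --> (kseries b nu (be + a) t)%:E.
  under eq_fun do rewrite intfn.
  by apply: cvg_EFin; [exact: nearW|exact: c1].
by rewrite /Rintegral (cvg_unique _ h2 c2).
Qed.

End kseries.

Section kseries_derive.
Context {R : realType}.
Variables (nu : R) (nu0 : 0 < nu).
Implicit Types (b c : nat -> R) (be s t a : R).

Lemma integrable_kseries b be t : 0 < be -> geom_bounded b -> 0 < t ->
  leb.-integrable `]0, t[ (EFin \o kseries b nu be).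
Proof.
move=> be0 hb t0; apply: (@integrable_of_kernM _ 1) => //.
by have [] := frac_kseries nu0 be0 ltr01 hb t0.
Qed.

(** Instead of being differentiated termwise, the series is recognised as the primitive of the
    series with parameter [be - 1], which is continuous at positive arguments. *)
Lemma is_derive_kseries b be s : 1 < be -> geom_bounded b -> 0 < s ->
  is_derive s (1 : R) (kseries b nu be) (kseries b nu (be - 1) s).
Proof.
move=> be1 hb s0; have be10 : 0 < be - 1 by rewrite subr_gt0.
have s10 : 0 < s + 1 by rewrite addr_gt0.
have s11 : 0 < s + 1 + 1 by rewrite addr_gt0.
have iu y : leb.-integrable `]0, y] (EFin \o kseries b nu (be - 1)).
  have y1 : 0 < `|y| + 1 by rewrite ltr_wpDl.
  apply: integrableS (integrable_kseries be10 hb y1) => //.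
  by apply: subset_itvl; rewrite bnd_simp (le_lt_trans (ler_norm y))// ltrDl.
pose F y := \int[leb]_(x in `]0, y]) kseries b nu (be - 1) x.
have ss1 : s < s + 1 by rewrite ltrDl.
have s0' : (BRight 0 < BRight s)%O by rewrite bnd_simp.
have [dF F'] := @continuous_FTC1 R _ (BRight 0) s (s + 1) ss1 (iu _) s0'
  (continuous_kseries nu0 be10 hb s0).
have d : is_derive s (1 : R) F (kseries b nu (be - 1) s).
  by apply: DeriveDef; [exact: dF|rewrite -derive1E; exact: F'].
apply: near_eq_is_derive d; near=> y.
have y0 : 0 < y by near: y; exact: lt_nbhsr.
have [_] := frac_kseries nu0 be10 ltr01 hb y0; rewrite subrK => <-.
rewrite frac1 /F Rintegral_itv_bndo_bndc//.
by apply: integrableS (iu y) => //; apply: subset_itvl; rewrite bnd_simp.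
Unshelve. all: by end_near. Qed.

Lemma kseriesD b c be s : 0 < be -> geom_bounded b -> geom_bounded c ->
  kseries (fun n => b n + c n) nu be s = kseries b nu be s + kseries c nu be s.
Proof.
move=> be0 hb hc; rewrite /kseries -lim_seriesD; [|exact: kseries_cvg|exact: kseries_cvg].
by congr (limn (series _)); apply/funext => n /=; rewrite mulrDl.
Qed.

Lemma kseriesZ b k be s : 0 < be -> geom_bounded b ->
  kseries (fun n => k * b n) nu be s = k * kseries b nu be s.
Proof.
move=> be0 hb; have := @lim_seriesZ _ _ k (@kseries_cvg _ _ nu0 _ _ s be0 hb).
rewrite /GRing.scale/= /kseries => <-.
by congr (limn (series _)); apply/funext => n; exact/esym/mulrA.
Qed.

Lemma geom_boundedS b m : geom_bounded b -> geom_bounded (fun n => b (n + m)%N).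
Proof.
by move=> [C [B hb]]; exists (C * B ^+ m), B => n; rewrite -mulrA -exprD addnC hb.
Qed.

Lemma eq_kseries b c be s : b =1 c -> kseries b nu be s = kseries c nu be s.
Proof. by move=> bc; congr kseries; exact/funext. Qed.

Lemma caputo_kseries b be mu (m : nat) (u : R -> R) : m%:R - 1 < mu -> mu <= m%:R ->
  0 < be -> geom_bounded b ->
  (forall s, 0 < s -> derive1n m u s = kseries b nu be s) ->
  (mu < m%:R -> forall t, 0 < t ->
    leb.-integrable `]0, t[ (EFin \o caputo_integrand mu u t)) /\
  forall t, 0 < t -> caputo mu u t = kseries b nu (be + (m%:R - mu)) t.
Proof.
move=> h1 h2 be0 hb E.
have ik : mu < m%:R -> forall t, 0 < t ->
    leb.-integrable `]0, t[ (EFin \o (fun s => kern (m%:R - mu) (t - s) * derive1n m u s)).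
  move=> h3 t t0; have mmu : 0 < m%:R - mu by rewrite subr_gt0.
  have [+ _] := frac_kseries nu0 be0 mmu hb t0.
  by apply: eq_integrable => // s /set_mem/= sI; rewrite E// (itvP sI).
split.
  by move=> h3 t t0; apply/(integrable_caputo_integrand u t h1 h3); exact: ik.
move=> t t0; have [mum|mum] := eqVneq mu m%:R.
  by rewrite mum subrr addr0 caputo_nat E.
have {h2 mum} h2 : mu < m%:R by rewrite lt_neqAle mum.
have mmu : 0 < m%:R - mu by rewrite subr_gt0.
rewrite (caputoE h1 h2 (ik h2 t t0)).
have [_ <-] := frac_kseries nu0 be0 mmu hb t0.
by apply: eq_frac => s sI; rewrite E// (itvP sI).
Qed.

End kseries_derive.

(** * The explicit solution *)

Section coefficients.
Context {R : realType}.
Variables (lam nu : R) (lam0 : 0 < lam) (nu0 : 0 < nu).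
Implicit Types (k m n : nat) (t : R).

(** Up to the sign [(-1) ^ m], the coefficients of [y ^ m / (1 + y) ^ (m + 1)] at [y = l X]. The
    sign turns the sum of the cases [2 k] and [2 k + 1] into a difference. *)
Definition binom_coef (l : R) m n : R := (- l) ^+ n * 'C(n, m)%:R.

(* Coefficients of [x ^+ (2 * k) * (1 + 2 * x) / (1 + x) ^+ (2 * k + 2)] at [x = lam * X]; here
   [X ^+ n] stands for [kern (nu * n%:R + 1)]. *)
Definition sol_coef (l : R) k n : R := binom_coef l (2 * k) n - binom_coef l (2 * k + 1) n.

Lemma bin_le_expn n m : ('C(n, m) <= 2 ^ n)%N.
Proof.
elim: n m => [|n IH] [|m]; rewrite ?bin0 ?bin0n ?expn_gt0// binS expnS mul2n -addnn.
exact: leq_add.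
Qed.

Lemma geom_bounded_binom m : geom_bounded (binom_coef lam m).
Proof.
exists 1, (2 * lam) => n; rewrite /binom_coef normrM normrX normrN (gtr0_norm lam0) mul1r.
rewrite exprMn mulrC ler_wpM2r ?exprn_ge0 ?(ltW lam0)//.
by rewrite ger0_norm// -natrX ler_nat bin_le_expn.
Qed.

Lemma geom_boundedD (b c : nat -> R) : geom_bounded b -> geom_bounded c ->
  geom_bounded (fun n => b n + c n).
Proof.
move=> [C [B hb]] [C' [B' hc]].
exists (`|C| + `|C'|), (`|B| + `|B'|) => n.
have BB : `|B| <= `|B| + `|B'| by rewrite lerDl.
have BB' : `|B'| <= `|B| + `|B'| by rewrite lerDr.
rewrite (le_trans (ler_normD _ _))// mulrDl lerD//.
- rewrite (le_trans (hb n))// (le_trans (ler_norm _))// normrM normrX.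
  by rewrite ler_wpM2l// lerXn2r// nnegrE ?addr_ge0.
- rewrite (le_trans (hc n))// (le_trans (ler_norm _))// normrM normrX.
  by rewrite ler_wpM2l// lerXn2r// nnegrE ?addr_ge0.
Qed.

Lemma geom_boundedZ (b : nat -> R) (l : R) : geom_bounded b -> geom_bounded (fun n => l * b n).
Proof.
move=> [C [B hb]]; exists (`|l| * C), B => n.
by rewrite normrM -mulrA ler_wpM2l.
Qed.

Lemma geom_bounded_sol k : geom_bounded (sol_coef lam k).
Proof.
rewrite (_ : sol_coef lam k = fun n => binom_coef lam (2 * k) n + -1 * binom_coef lam (2 * k + 1) n).
  by apply: geom_boundedD; [|apply: geom_boundedZ]; exact: geom_bounded_binom.
by apply/funext => n; rewrite mulN1r.
Qed.

Lemma sol_coef0 k : sol_coef lam k 0 = (k == 0%N)%:R.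
Proof. by rewrite /sol_coef /binom_coef !bin0n !expr0 !mul1r addn1 subr0 muln_eq0. Qed.

Lemma sol_coef1 k : sol_coef lam k 1 = 0.
Proof.
case: k => [|k]; rewrite /sol_coef /binom_coef; first by rewrite !muln0 subrr.
by rewrite !bin_small ?mulr0 ?subrr// mulnS.
Qed.

(** This is [(1 + lam X)^2 u_k = lam^2 X^2 u_(k-1)] at the power [X^(n + 2)], where the right side
    [1 + 2 lam X] of the case [k = 0] contributes nothing. For [k > 0] it follows from Pascal's
    rule. *)
Lemma sol_coef_rec k n : sol_coef lam k (n + 2) + 2 * lam * sol_coef lam k (n + 1) =
  - lam ^+ 2 * (sol_coef lam k n - (if k is j.+1 then sol_coef lam j n else 0)).
Proof.
case: k => [|k]; rewrite /sol_coef /binom_coef !addn2 !addn1 !exprS.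
  by rewrite !muln0 !bin0 !bin1 -addn1 -[n.+1]addn1 !natrD; ring.
rewrite !mulnS !add2n !binS !natrD; ring.
Qed.

Lemma pochhammer_fact m n : pochhammer (m.+1%:R : R) n * m`!%:R = (m + n)`!%:R.
Proof.
rewrite /pochhammer; elim: n => [|n IH]; first by rewrite big_ord0 mul1r addn0.
by rewrite big_ord_recr/= mulrAC IH addnS factS natrM mulrC -natrD.
Qed.

Lemma pochhammer_bin m n : pochhammer (m.+1%:R : R) n / n`!%:R = 'C(n + m, m)%:R.
Proof.
have m0 : (m`!%:R : R) != 0 by rewrite pnatr_eq0 -lt0n fact_gt0.
have n0 : (n`!%:R : R) != 0 by rewrite pnatr_eq0 -lt0n fact_gt0.
apply: (mulIf m0); apply: (mulIf n0); rewrite mulrAC divfK// pochhammer_fact.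
by rewrite addnC -(bin_fact (leq_addl n m)) addnK !natrM mulrA.
Qed.

(** The coefficients below [m] vanish. The others contain ['C(n + m, m)], the rising factorial of
    [m + 1] over [n!], so the upper Mittag-Leffler parameter is the exponent in
    [(1 + y) ^ (m + 1)]. *)
Lemma kseries_mittag_leffler m t : 0 < t ->
  kseries (binom_coef lam m) nu 1 t =
  (-1) ^+ m * (lam ^+ m * t `^ (m%:R * nu) *
    mittag_leffler nu (m%:R * nu + 1) m.+1%:R (- lam * t `^ nu)).
Proof.
move=> t0; have hb := geom_bounded_binom m.
rewrite (kseries_addn nu0 t m ltr01 hb) big1_seq ?add0r; last first.
  move=> i; rewrite mem_index_iota => /andP[_ im].
  by rewrite /binom_coef bin_small// mulr0 mul0r.
have be0 : 0 < 1 + nu * m%:R by rewrite ltr_wpDr// mulr_ge0// ltW.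
have cv := @kseries_cvg _ _ nu0 _ _ t be0 (geom_boundedS m hb).
(* As [k] is nonzero, the Mittag-Leffler series inherits its convergence from the kernel series. *)
set k := (-1) ^+ m * lam ^+ m * t `^ (m%:R * nu).
have k0 : k != 0.
  rewrite !mulf_neq0 ?expf_neq0 ?oppr_eq0 ?oner_eq0 ?gt_eqF//; exact: powR_gt0.
rewrite /kseries /mittag_leffler !mulrA -/k.
set f := (X in limn (series X) = _) in cv *.
set g := (X in _ = k * limn (series X)).
have fg : f = k *: g.
  apply/funext => n; rewrite /f /g /GRing.scale/=.
  rewrite /binom_coef -pochhammer_bin (_ : nu * n%:R + (1 + nu * m%:R) = m%:R * nu + (nu * n%:R + 1)); last by ring.
  have o0 : 0 < nu * n%:R + 1 by exact: order_gt0.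
  rewrite kern_pos// (_ : m%:R * nu + (nu * n%:R + 1) - 1 = m%:R * nu + nu * n%:R); last by ring.
  rewrite powRD; last by apply/implyP => _; rewrite gt_eqF.
  rewrite [t `^ (nu * _)]powRrM powR_mulrn ?powR_ge0// /k.
  rewrite (_ : nu * n%:R + (m%:R * nu + 1) = m%:R * nu + (nu * n%:R + 1)); last by ring.
  rewrite exprD exprMn [(- lam) ^+ m]exprNn invfM /GRing.scale/=; ring.
have cg : cvgn (series g).
  rewrite (_ : g = k^-1 *: f); first exact: is_cvg_seriesZ.
  by rewrite fg scalerA mulVf// scale1r.
by rewrite fg lim_seriesZ.
Qed.

End coefficients.

#[global] Opaque kseries.

(** The constant term stands outside because all kernels are 0 at 0, where the initial value has to
    be attained. As the term in [X] is absent, the rest has parameter [2 nu + 1], which stays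
    positive after one derivative and, for [nu > 1 / 2], after two. *)
Definition solution (R : realType) (lam nu : R) (k : nat) (t : R) : R :=
  (k == 0%N)%:R + kseries (fun n => sol_coef lam k (n + 2)) nu (2 * nu + 1) t.

(** * Verification of the Cauchy problem *)

Section solution_facts.
Context {R : realType}.
Variables (lam nu : R) (lam0 : 0 < lam) (nu0 : 0 < nu) (nu1 : nu <= 1).
Implicit Types (k j m : nat) (s t : R).

Let d k := fun n => sol_coef lam k (n + 2).

Let gd k : geom_bounded (d k).
Proof. exact/geom_boundedS/geom_bounded_sol. Qed.

Let nu20 : 0 < 2 * nu. Proof. by rewrite mulr_gt0. Qed.
Let nu210 : 0 < 2 * nu + 1. Proof. by rewrite addr_gt0. Qed.

Lemma solution_kseries k t : 0 < t ->
  solution lam nu k t = kseries (sol_coef lam k) nu 1 t.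
Proof.
move=> t0.
have E : \sum_(0 <= i < 2) sol_coef lam k i * kern (nu * i%:R + 1) t = (k == 0%N)%:R.
  rewrite big_nat_recr//= big_nat1 sol_coef0 sol_coef1 mul0r addr0 mulr0 add0r.
  by rewrite kern1 ?mulr1.
rewrite (kseries_addn nu0 t 2 ltr01 (geom_bounded_sol lam0 k)) E /solution.
by have -> : 2 * nu + 1 = 1 + nu * 2%:R by ring.
Qed.

Lemma solution0 k : solution lam nu k 0 = (k == 0%N)%:R.
Proof. by rewrite /solution kseries0 addr0. Qed.

Lemma is_derive_solution k s : 0 < s ->
  is_derive s (1 : R) (solution lam nu k) (kseries (d k) nu (2 * nu) s).
Proof.
move=> s0; have b1 : 1 < 2 * nu + 1 by rewrite ltrDr.
have := is_derive_kseries nu0 b1 (gd k) s0; rewrite addrK => dk.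
have := @is_deriveD _ _ _ (cst ((k == 0%N)%:R : R)) (kseries (d k) nu (2 * nu + 1)) s 1 0 _ _ dk.
by rewrite add0r; apply.
Qed.

Lemma derive1_solution k s : 0 < s ->
  derive1n 1 (solution lam nu k) s = kseries (d k) nu (2 * nu) s.
Proof.
move=> s0; have dk := is_derive_solution k s0.
by rewrite /= derive1E; exact: derive_val.
Qed.

Lemma is_derive2_solution k s : 1 < 2 * nu -> 0 < s ->
  is_derive s (1 : R) (derive1n 1 (solution lam nu k)) (kseries (d k) nu (2 * nu - 1) s).
Proof.
move=> nu2 s0; have dk := is_derive_kseries nu0 nu2 (gd k) s0.
apply: near_eq_is_derive dk; near=> y.
by rewrite derive1_solution//; near: y; exact: lt_nbhsr.
Unshelve. all: by end_near. Qed.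

Lemma derive2_solution k s : 1 < 2 * nu -> 0 < s ->
  derive1n 2 (solution lam nu k) s = kseries (d k) nu (2 * nu - 1) s.
Proof.
move=> nu2 s0; have dk := is_derive2_solution k nu2 s0.
by rewrite derive1nS derive1E; exact: derive_val.
Qed.

Lemma caputo_solution k :
  caputo_derivable nu (solution lam nu k) /\
  forall t, 0 < t -> caputo nu (solution lam nu k) t = kseries (d k) nu (nu + 1) t.
Proof.
have h1 : 1%:R - 1 < nu by rewrite subrr.
have [ci E] := caputo_kseries nu0 h1 nu1 nu20 (gd k) (derive1_solution k).
rewrite (_ : 2 * nu + (1%:R - nu) = nu + 1) in E; last by ring.
split; last exact: E.
rewrite /caputo_derivable (caputo_orderE h1 nu1); split.
  by move=> [|//] s _ s0 /=; have [] := is_derive_solution k s0.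
by move=> nuN1 t t0; apply: ci => //; rewrite lt_neqAle nuN1.
Qed.

Lemma caputo2_solution k :
  caputo_derivable (2 * nu) (solution lam nu k) /\
  forall t, 0 < t -> caputo (2 * nu) (solution lam nu k) t = kseries (d k) nu 1 t.
Proof.
have [nuh|nuh] := leP (2 * nu) 1.
  have h1 : 1%:R - 1 < 2 * nu by rewrite subrr.
  have [ci E] := caputo_kseries nu0 h1 nuh nu20 (gd k) (derive1_solution k).
  rewrite (_ : 2 * nu + (1%:R - 2 * nu) = 1) in E; last by ring.
  split; last exact: E.
  rewrite /caputo_derivable (caputo_orderE h1 nuh); split.
    by move=> [|//] s _ s0 /=; have [] := is_derive_solution k s0.
  by move=> nuN1 t t0; apply: ci => //; rewrite lt_neqAle nuN1.
have h1 : 2%:R - 1 < 2 * nu by rewrite [2%:R]mulr2n addrK.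
have h2 : 2 * nu <= 2%:R by rewrite ler_piMr.
have h3 : 0 < 2 * nu - 1 by rewrite subr_gt0.
have [ci E] := caputo_kseries nu0 h1 h2 h3 (gd k) (fun s => @derive2_solution k s nuh).
rewrite (_ : 2 * nu - 1 + (2%:R - 2 * nu) = 1) in E; last by ring.
split; last exact: E.
rewrite /caputo_derivable (caputo_orderE h1 h2); split.
  move=> [|[|//]] s _ s0; first by have [] := is_derive_solution k s0.
  by have [] := is_derive2_solution k nuh s0.
by move=> nuN1 t t0; apply: ci => //; rewrite lt_neqAle nuN1.
Qed.

Lemma solution_equation k t : 0 < t ->
  caputo (2 * nu) (solution lam nu k) t + 2 * lam * caputo nu (solution lam nu k) t =
  - lam ^+ 2 * (solution lam nu k t - Defs.prev (solution lam nu) k t).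
Proof.
move=> t0; have [_ ->//] := caputo_solution k; have [_ ->//] := caputo2_solution k.
have gs j := geom_bounded_sol lam0 j.
have gs1 : geom_bounded (fun n => sol_coef lam k (n + 1)) by exact: geom_boundedS.
(* Because the coefficient of [X] is 0, a vanishing first term can be prepended. All series then
   have parameter 1, and the equation reduces to the recurrence of the coefficients. *)
have -> : kseries (d k) nu (nu + 1) t = kseries (fun n => sol_coef lam k (n + 1)) nu 1 t.
  rewrite [RHS](kseries_addn nu0 t 1 ltr01 gs1) big_nat1 sol_coef1 mul0r add0r mulr1 [1 + nu]addrC.
  by apply: eq_kseries => n; rewrite -addnA.
pose e n : R := if k is j.+1 then sol_coef lam j n else 0.
have ge_ : geom_bounded e.
  rewrite /e; case: (k) => [|j]; last exact: gs.
  by exists 0, 0 => n; rewrite normr0 mul0r.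
have -> : Defs.prev (solution lam nu) k t = kseries e nu 1 t.
  rewrite /e; case: (k) => [|j] /=; last exact: solution_kseries.
  have g0 : geom_bounded (fun=> 0 : R) by exists 0, 0 => n; rewrite normr0 mul0r.
  rewrite -[LHS](mul0r (kseries (fun=> 0) nu 1 t)) -(kseriesZ nu0 0 t ltr01 g0).
  by apply: eq_kseries => n; rewrite mul0r.
rewrite solution_kseries//.
have gz l (b : nat -> R) : geom_bounded b -> geom_bounded (fun n => l * b n).
  exact: geom_boundedZ.
rewrite -(kseriesZ nu0 (2 * lam) t ltr01 gs1) -(kseriesD nu0 t ltr01 (gd k) (gz _ _ gs1)).
rewrite -[- kseries e nu 1 t]mulN1r -(kseriesZ nu0 (-1) t ltr01 ge_) -(kseriesD nu0 t ltr01 (gs k) (gz _ _ ge_)).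
rewrite -(kseriesZ nu0 _ t ltr01 (geom_boundedD (gs k) (gz _ _ ge_))).
by apply: eq_kseries => n; rewrite mulN1r; exact: sol_coef_rec.
Qed.

(** The power [s ^ (2 nu)] gives continuity at 0 and, divided by [s], the zero slope for
    [nu > 1 / 2]. *)
Lemma solution_small k : exists C, forall s, 0 < s -> s <= 1 ->
  `|solution lam nu k s - solution lam nu k 0| <= C * s `^ (2 * nu).
Proof.
have [C hC] := kseries_small nu0 nu210 (gd k).
exists C => s s0 s1; rewrite solution0 /solution addrAC subrr add0r.
by have := hC s s0 s1; rewrite addrK.
Qed.

Lemma continuous_solution k : {within `[0, +oo[, continuous (solution lam nu k)}.
Proof.
apply/continuous_within_itvcyP; split.
  move=> s; rewrite in_itv/= andbT => s0; apply: derivable_continuous.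
  by have [] := is_derive_solution k s0.
have [C hC] := solution_small k.
have c0 : C * s `^ (2 * nu) @[s --> 0^'+] --> (0 : R).
  by rewrite -[X in _ --> X](mulr0 C); apply: cvgM; [exact: cvg_cst|exact: powR_cvg0].
apply/cvgrPdist_le => e e0; move/cvgrPdist_le : c0 => /(_ e e0) hc.
near=> s.
have s0 : 0 < s by near: s; exact: nbhs_right_gt.
have s1 : s <= 1 by near: s; exact: nbhs_right_le.
rewrite distrC (le_trans (hC s s0 s1))//.
have : `|0 - C * s `^ (2 * nu)| <= e by near: s; exact: hc.
by rewrite sub0r normrN; apply: le_trans; exact: ler_norm.
Unshelve. all: by end_near. Qed.

Lemma solution_init' k : 1 / 2 < nu ->
  (solution lam nu k h - solution lam nu k 0) / h @[h --> 0^'+] --> (0 : R).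
Proof.
move=> nuh; have [C hC] := solution_small k.
have nu2 : 0 < 2 * nu - 1 by rewrite subr_gt0 mulrC -ltr_pdivrMr.
have c0 : C * s `^ (2 * nu - 1) @[s --> 0^'+] --> (0 : R).
  by rewrite -[X in _ --> X](mulr0 C); apply: cvgM; [exact: cvg_cst|exact: powR_cvg0].
apply/cvgrPdist_le => e e0; move/cvgrPdist_le : c0 => /(_ e e0) hc.
near=> s.
have s0 : 0 < s by near: s; exact: nbhs_right_gt.
have s1 : s <= 1 by near: s; exact: nbhs_right_le.
rewrite sub0r normrN normrM [`|s^-1|]gtr0_norm ?invr_gt0// ler_pdivrMr//.
apply: (le_trans (hC s s0 s1)); rewrite -(mulr_powRB1 (ltW s0) nu20) mulrCA mulrC.
rewrite ler_pM2r//.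
have : `|0 - C * s `^ (2 * nu - 1)| <= e by near: s; exact: hc.
by rewrite sub0r normrN; apply: le_trans; exact: ler_norm.
Unshelve. all: by end_near. Qed.

Lemma solution_cauchy : cauchy_solution lam nu (solution lam nu).
Proof.
split.
- exact: continuous_solution.
- by move=> k; have [] := caputo_solution k.
- by move=> k; have [] := caputo2_solution k.
- exact: solution_equation.
- by move=> k; rewrite solution0; case: k.
- by move=> nuh k; exact: solution_init'.
Qed.

End solution_facts.

Theorem theorem3p1 (R : realType) (lam nu : R)
    (hlam : 0 < lam) (hnu0 : 0 < nu) (hnu1 : nu <= 1) :
  (exists p : nat -> R -> R, cauchy_solution lam nu p) /\
  (forall p : nat -> R -> R, cauchy_solution lam nu p ->
    forall (k : nat) (t : R), 0 < t ->
      p k t =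
        lam ^+ (2 * k) * t `^ ((2 * k)%:R * nu) *
          mittag_leffler nu ((2 * k)%:R * nu + 1) (2 * k + 1)%:R
            (- lam * t `^ nu) +
        lam ^+ (2 * k + 1) * t `^ ((2 * k + 1)%:R * nu) *
          mittag_leffler nu ((2 * k + 1)%:R * nu + 1) (2 * k + 2)%:R
            (- lam * t `^ nu)).
Proof.
have sol := solution_cauchy hlam hnu0 hnu1.
split; first by exists (solution lam nu).
move=> p solp k t t0.
rewrite (solution_unique k hlam hnu0 hnu1 solp sol t0) (solution_kseries hlam hnu0 k t0).
have g m := geom_bounded_binom hlam m.
have -> : kseries (sol_coef lam k) nu 1 t =
    kseries (binom_coef lam (2 * k)) nu 1 t + -1 * kseries (binom_coef lam (2 * k + 1)) nu 1 t.
  rewrite -(kseriesZ hnu0 (-1) t ltr01 (g _)).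
  rewrite -(kseriesD hnu0 t ltr01 (g _) (geom_boundedZ (-1) (g _))).
  by apply: eq_kseries => n; rewrite mulN1r.
(* The sign [(-1) ^ (2 k)] is 1, and [(-1) ^ (2 k + 1) = -1] cancels the minus in [sol_coef]. *)
rewrite !kseries_mittag_leffler// addn1 addn2 exprS exprM sqrrN !expr1n mulr1.
by rewrite mulrA mulrNN !mul1r.
Qed.
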